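(* Let $V$ be a real vector space, $R:V\to\mathbb{R}\cup\{+\infty\}$ and $f:\mathbb{R}^m\to\mathbb{R}\cup\{+\infty\}$ convex, $\Phi:V\to\mathbb{R}^m$ linear surjective, and $S$ the set of minimizers of $\min_u R(u)+f(\Phi u)$. Assume $p\in S$, $R(p)+f(\Phi p)<+\infty$, and $\mathrm{lev}_R(p)=\{u: R(u)\le R(p)\}$ is linearly closed. Let $K=\mathrm{lin}(\mathrm{lev}_R(p))$, $d=\dim\Phi(K)$, $L=\ker\Phi$, and let $\ell$ be the dimension of the minimal face of $\Phi p$ in $\mathrm{lev}_f(\Phi p)=\{w: f(w)\le f(\Phi p)\}$. If $\dim\big(\pi_{K\cap L}(F(p,S))\big)=j<+\infty$, then $\pi_K(p)$ belongs to a face of $\pi_K(\mathrm{lev}_R(p))$ of dimension at most $k$, where $$k=\begin{cases} m-\ell+j-d-1 & \text{if } R(p)>\inf R \text{ or } f(\Phi p)>\inf f,\\ m-\ell+j-d & \text{otherwise.}\end{cases}$$ In particular, $\pi_K(p)$ can be written either as a convex combination of at most $k+1$ extreme points of $\pi_K(\mathrm{lev}_R(p))$, or as a convex combination of at most $k$ points of $\pi_K(\mathrm{lev}_R(p))$, each an extreme point or a point of an extreme ray of $\pi_K(\mathrm{lev}_R(p))$. If, moreover, $p$ satisfies the double obliqueness condition, $k$ can be replaced by $m-\ell+j-d-2$.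
   Context: For a convex set $C$ in a real vector space: open segment $]x,y[=\{tx+(1-t)y:0<t<1\}$ ($x\ne y$); a face of $C$ is a convex $F\subseteq C$ such that every open segment contained in $C$ intersecting $F$ is contained in $F$; the dimension of a convex set/face is that of its affine hull; $F(x,C)$ is the intersection of all faces of $C$ containing $x$; extreme point: $\{x\}$ is a face; extreme ray: a half-line $\{a+tv:t>0\}$, $v\neq0$, contained in $C$ which is a face. $C$ is linearly closed if its intersection with every line is closed in that line. The lineality space of a nonempty convex $C$ is $\mathrm{lin}(C)=\{v: C+\mathbb{R}v\subseteq C\}$. For a subspace $W\subseteq V$, $\pi_W:V\to V/W$ is the canonical quotient map. Double obliqueness: with $M=R(p)+f(\Phi p)$, $\mathrm{epi}(R)=\{(u,r): R(u)\le r\}\subseteq V\times\mathbb{R}$, $\mathrm{hypo}(M-f)=\{(w,r): M-f(w)\ge r\}\subseteq\mathbb{R}^m\times\mathbb{R}$; for convex $C\subseteq X\times\mathbb{R}$ and $(x,r)\in C$, $F((x,r),C)$ is oblique if its affine hull is not contained in $X\times\{r\}$; $p$ satisfies the double obliqueness condition if $F((p,R(p)),\mathrm{epi}(R))$ and $F((\Phi p,M-f(\Phi p)),\mathrm{hypo}(M-f))$ are both oblique. *)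

(* Defs.v *)
From Stdlib Require Import Reals Lra Rtopology FunctionalExtensionality ZArith.
From Stdlib Require Fin.
Open Scope R_scope.

Record RVS : Type := mkRVS {
  car :> Type;
  vadd : car -> car -> car;
  vzero : car;
  vopp : car -> car;
  vscal : R -> car -> car;
  vaddA : forall x y z, vadd x (vadd y z) = vadd (vadd x y) z;
  vaddC : forall x y, vadd x y = vadd y x;
  vadd0 : forall x, vadd x vzero = x;
  vaddN : forall x, vadd x (vopp x) = vzero;
  vscalA : forall a b x, vscal a (vscal b x) = vscal (a * b) x;
  vscal1 : forall x, vscal 1 x = x;
  vscalDr : forall a x y, vscal a (vadd x y) = vadd (vscal a x) (vscal a y);
  vscalDl : forall a b x, vscal (a + b) x = vadd (vscal a x) (vscal b x) }.
Arguments vadd {r} _ _.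
Arguments vzero {r}.
Arguments vopp {r} _.
Arguments vscal {r} _ _.

Definition Rn (m : nat) : RVS.
Proof.
  refine (@mkRVS (Fin.t m -> R) (fun x y i => x i + y i) (fun _ => 0)
    (fun x i => - x i) (fun a x i => a * x i) _ _ _ _ _ _ _ _);
  intros; apply functional_extensionality; intros; ring.
Defined.

Definition Rsp : RVS.
Proof.
  refine (@mkRVS R Rplus 0 Ropp Rmult _ _ _ _ _ _ _ _); intros; ring.
Defined.

Definition prodRVS (V W : RVS) : RVS.
Proof.
  refine (@mkRVS (car V * car W)%type
    (fun x y => (vadd (fst x) (fst y), vadd (snd x) (snd y)))
    (vzero, vzero) (fun x => (vopp (fst x), vopp (snd x)))
    (fun a x => (vscal a (fst x), vscal a (snd x))) _ _ _ _ _ _ _ _);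
  intros; simpl;
  repeat match goal with p : (_ * _)%type |- _ => destruct p end; simpl;
  f_equal; auto using vaddA, vaddC, vadd0, vaddN, vscalA, vscal1, vscalDr, vscalDl.
Defined.

Fixpoint vsum {V : RVS} (n : nat) (g : nat -> V) : V :=
  match n with O => vzero | S n' => vadd (vsum n' g) (g n') end.
Fixpoint rsum (n : nat) (g : nat -> R) : R :=
  match n with O => 0 | S n' => rsum n' g + g n' end.

Definition linear_map {V W : RVS} (T : V -> W) : Prop :=
  (forall x y, T (vadd x y) = vadd (T x) (T y)) /\
  (forall a x, T (vscal a x) = vscal a (T x)).

Definition surjective_map {V W : RVS} (T : V -> W) : Prop :=
  forall w, exists v, T v = w.

Definition image {V W : RVS} (T : V -> W) (A : V -> Prop) : W -> Prop :=
  fun w => exists v, A v /\ T v = w.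

Definition convex_set {V : RVS} (C : V -> Prop) : Prop :=
  forall x y t, C x -> C y -> 0 <= t <= 1 ->
    C (vadd (vscal t x) (vscal (1 - t) y)).

Definition open_seg {V : RVS} (x y : V) : V -> Prop :=
  fun z => exists t, 0 < t < 1 /\ z = vadd (vscal t x) (vscal (1 - t) y).

Definition subset {V : RVS} (A B : V -> Prop) : Prop := forall x, A x -> B x.

Definition face {V : RVS} (F C : V -> Prop) : Prop :=
  convex_set F /\ subset F C /\
  forall x y, x <> y -> subset (open_seg x y) C ->
    (exists z, open_seg x y z /\ F z) -> subset (open_seg x y) F.

Definition min_face {V : RVS} (x : V) (C : V -> Prop) : V -> Prop :=
  fun y => forall F, face F C -> F x -> F y.

Definition extreme_point {V : RVS} (x : V) (C : V -> Prop) : Prop :=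
  face (fun y => y = x) C.

Definition open_ray {V : RVS} (a v : V) : V -> Prop :=
  fun y => exists t, 0 < t /\ y = vadd a (vscal t v).

Definition in_extreme_ray {V : RVS} (z : V) (C : V -> Prop) : Prop :=
  exists a v, v <> vzero /\ subset (open_ray a v) C /\
    face (open_ray a v) C /\ open_ray a v z.

Definition aff_indep {V : RVS} (n : nat) (x : nat -> V) : Prop :=
  forall lam : nat -> R, rsum (S n) lam = 0 ->
    vsum (S n) (fun i => vscal (lam i) (x i)) = vzero ->
    forall i, (i <= n)%nat -> lam i = 0.

Definition affdim {V : RVS} (A : V -> Prop) (n : nat) : Prop :=
  (exists x : nat -> V, (forall i, (i <= n)%nat -> A (x i)) /\ aff_indep n x) /\
  (forall (n' : nat) (x : nat -> V), (forall i, (i <= n')%nat -> A (x i)) ->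
     aff_indep n' x -> (n' <= n)%nat).

(* the affine hull of A has dimension at most k (k an integer; -1 = empty) *)
Definition affdim_le {V : RVS} (A : V -> Prop) (k : Z) : Prop :=
  forall (n : nat) (x : nat -> V), (forall i, (i <= n)%nat -> A (x i)) ->
    aff_indep n x -> (Z.of_nat n <= k)%Z.

Definition aff_hull {V : RVS} (A : V -> Prop) : V -> Prop :=
  fun z => exists (n : nat) (x : nat -> V) (lam : nat -> R),
    (forall i, (i < n)%nat -> A (x i)) /\ rsum n lam = 1 /\
    vsum n (fun i => vscal (lam i) (x i)) = z.

Definition conv_comb {V : RVS} (n : nat) (x : nat -> V) (lam : nat -> R) (y : V) : Prop :=
  (forall i, (i < n)%nat -> 0 <= lam i) /\ rsum n lam = 1 /\
  vsum n (fun i => vscal (lam i) (x i)) = y.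

Definition linearly_closed {V : RVS} (C : V -> Prop) : Prop :=
  forall x v : V, closed_set (fun t => C (vadd x (vscal t v))).

Definition lineality {V : RVS} (C : V -> Prop) : V -> Prop :=
  fun v => forall x t, C x -> C (vadd x (vscal t v)).

Inductive ereal : Type := EFin (r : R) | EInf.

Definition ele (a b : ereal) : Prop :=
  match a, b with
  | EFin x, EFin y => x <= y
  | _, EInf => True
  | EInf, EFin _ => False
  end.
Definition elt (a b : ereal) : Prop :=
  match a, b with
  | EFin x, EFin y => x < y
  | EFin _, EInf => True
  | EInf, _ => False
  end.
Definition eadd (a b : ereal) : ereal :=
  match a, b with EFin x, EFin y => EFin (x + y) | _, _ => EInf end.
(* real part of a finite extended real (only used on finite values) *)
Definition real_of (a : ereal) : R := match a with EFin x => x | EInf => 0 end.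

(* convexity of an extended-real valued function = convexity of its epigraph *)
Definition convex_fun {V : RVS} (g : V -> ereal) : Prop :=
  forall (u v : V) (a b t : R), ele (g u) (EFin a) -> ele (g v) (EFin b) ->
    0 <= t <= 1 ->
    ele (g (vadd (vscal t u) (vscal (1 - t) v))) (EFin (t * a + (1 - t) * b)).

Definition lev {V : RVS} (g : V -> ereal) (x : V) : V -> Prop :=
  fun u => ele (g u) (g x).

Definition epi {V : RVS} (g : V -> ereal) : prodRVS V Rsp -> Prop :=
  fun z => ele (g (fst z)) (EFin (snd z)).

(* hypograph of M - f, with M real: { (w,r) | M - f(w) >= r } *)
Definition hypo_Mminus {W : RVS} (M : R) (g : W -> ereal) : prodRVS W Rsp -> Prop :=
  fun z => ele (eadd (g (fst z)) (EFin (snd z))) (EFin M).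

Definition oblique {X : RVS} (x : X) (r : R) (C : prodRVS X Rsp -> Prop) : Prop :=
  ~ (forall z, aff_hull (min_face ((x, r) : prodRVS X Rsp) C) z -> snd z = r).

Definition face_bound {Q : RVS} (y : Q) (C : Q -> Prop) (k : Z) : Prop :=
  (exists F, face F C /\ F y /\ affdim_le F k) /\
  ((exists (n : nat) (x : nat -> Q) (lam : nat -> R),
      (Z.of_nat n <= k + 1)%Z /\ (forall i, (i < n)%nat -> extreme_point (x i) C) /\
      conv_comb n x lam y) \/
   (exists (n : nat) (x : nat -> Q) (lam : nat -> R),
      (Z.of_nat n <= k)%Z /\
      (forall i, (i < n)%nat -> extreme_point (x i) C \/ in_extreme_ray (x i) C) /\
      conv_comb n x lam y)).

(* Main.v *)
Require Import Defs.
From Stdlib Require Import Reals ZArith.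
From Stdlib Require Import Rtopology Lra Lia Arith List Classical FunctionalExtensionality.
Open Scope R_scope.

(** Faces are relatively open here, so the affine hull of the minimal face of [x] in a convex set
    [C] is [x + D(x,C)], where [D(x,C)] is the space of those [v] with [x + ev] and [x - ev] in [C]
    for some [e > 0].

    Write [D_R], [D_f], [D_S] for these spaces at [p] in [lev_R(p)], at [Phi p] in
    [levf_iff(Phi p)], and at [p] in [S]. Then [D_R /\ Phi^-1(D_f)] lies in [D_S], hence has dimension
    at most [j] modulo [K /\ L], and the rank theorem for [D_R -> R^m / D_f] gives
    [dim D_R / K <= m - l + j - d]. If [R] or [f] can be strictly decreased, optimality of [p]
    forbids [Phi(D_R) + D_f = R^m], which gains one dimension. In the oblique case the same
    count is done with the direction spaces of [epi R] and [hypo (M - f)], each one dimension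
    larger, and the vertical vector [(0,1)] cannot be in the sum.

    The quotient [C] of [lev_R(p)] by [K] is convex, linearly closed and contains no line, and a
    point of [C] whose minimal face has dimension [k] is a convex combination of finitely many
    extreme points and points of extreme rays: follow a chord through it that is bounded on both
    sides and induct on the dimension. A Caratheodory-type exchange then reduces the number of
    points: an affine dependency involving a point [a + r] of an extreme ray with origin [a]
    allows one to remove some point or to replace [a + r] by [a]. *)

(** * Vector identities by reflection *)

Infix "⊕" := vadd (at level 50, left associativity).
Infix "⊙" := vscal (at level 40, left associativity).
Notation "x ⊖ y" := (vadd x (vopp y)) (at level 50, left associativity).

(** Scalars are kept as opaque reals, so a vector identity reduces to one real equation per atom. *)
Inductive vexp : Type :=
  | VVar (i : nat) | VZero | VAdd (a b : vexp) | VOpp (a : vexp) | VScal (c : R) (a : vexp).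

Fixpoint veval {V : RVS} (l : list V) (e : vexp) : V :=
  match e with
  | VVar i => nth i l vzero
  | VZero => vzero
  | VAdd a b => veval l a ⊕ veval l b
  | VOpp a => vopp (veval l a)
  | VScal c a => c ⊙ veval l a
  end.

(** Kronecker delta, written by recursion so that it computes to 0 or 1 on concrete indices. *)
Fixpoint vidx (i k : nat) : R :=
  match i, k with O, O => 1 | S i', S k' => vidx i' k' | _, _ => 0 end.

Fixpoint vcoef (e : vexp) (k : nat) : R :=
  match e with
  | VVar i => vidx i k
  | VZero => 0
  | VAdd a b => vcoef a k + vcoef b k
  | VOpp a => - vcoef a k
  | VScal c a => c * vcoef a k
  end.

Fixpoint vlin {V : RVS} (l : list V) (c : nat -> R) : V :=
  match l with nil => vzero | x :: l' => c O ⊙ x ⊕ vlin l' (fun k => c (S k)) end.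

Fixpoint vagree {V : RVS} (l : list V) (c c' : nat -> R) : Prop :=
  match l with
  | nil => True
  | _ :: l' => c O = c' O /\ vagree l' (fun k => c (S k)) (fun k => c' (S k))
  end.

Section RVSBasics.
Context {V : RVS}.
Implicit Types x y : V.

Lemma vadd0l x : vzero ⊕ x = x.
Proof. rewrite vaddC; apply vadd0. Qed.

Lemma vadd_cancel x y z : x ⊕ y = x ⊕ z -> y = z.
Proof.
  intros H. rewrite <- (vadd0l y), <- (vadd0l z), <- (vaddN _ x).
  rewrite (vaddC _ x (vopp x)), <- !vaddA. now rewrite H.
Qed.

Lemma vscal0l x : 0 ⊙ x = vzero.
Proof.
  apply vadd_cancel with (1 ⊙ x). rewrite <- vscalDl, vadd0. f_equal; ring.
Qed.

Lemma vscal0r a : a ⊙ (vzero : V) = vzero.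
Proof. rewrite <- (vscal0l vzero), vscalA. f_equal; ring. Qed.

Lemma voppE x : vopp x = (-1) ⊙ x.
Proof.
  apply vadd_cancel with x. rewrite vaddN.
  rewrite <- (vscal1 _ x) at 1. rewrite <- vscalDl.
  replace (1 + -1) with 0 by ring. now rewrite vscal0l.
Qed.

Lemma vadd4 (a b c d : V) : (a ⊕ b) ⊕ (c ⊕ d) = (a ⊕ c) ⊕ (b ⊕ d).
Proof.
  rewrite <- !vaddA. f_equal. rewrite !vaddA. f_equal. apply vaddC.
Qed.

Lemma vlin_zero (l : list V) : vlin l (fun _ => 0) = vzero.
Proof. induction l; simpl; auto. now rewrite IHl, vscal0l, vadd0. Qed.

Lemma vlin_add (l : list V) : forall c c', vlin l (fun k => c k + c' k) = vlin l c ⊕ vlin l c'.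
Proof.
  induction l; intros; simpl. now rewrite vadd0.
  rewrite (IHl (fun k => c (S k)) (fun k => c' (S k))), vscalDl. apply vadd4.
Qed.

Lemma vlin_scal (l : list V) a : forall c, vlin l (fun k => a * c k) = a ⊙ vlin l c.
Proof.
  induction l; intros; simpl. now rewrite vscal0r.
  now rewrite (IHl (fun k => c (S k))), vscalDr, vscalA.
Qed.

Lemma vlin_ext (l : list V) : forall c c', vagree l c c' -> vlin l c = vlin l c'.
Proof.
  induction l; intros c c' H; simpl in *; auto.
  destruct H as [H1 H2]. rewrite H1. f_equal. now apply IHl.
Qed.

Lemma vlin_var (l : list V) : forall i, vlin l (vidx i) = nth i l vzero.
Proof.
  induction l; intros [|i]; simpl; auto.
  - rewrite vlin_zero, vscal1, vadd0; auto.
  - change (fun k => vidx i k) with (vidx i). now rewrite IHl, vscal0l, vadd0l.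
Qed.

Lemma veval_vlin (l : list V) e : veval l e = vlin l (vcoef e).
Proof.
  induction e; simpl.
  - symmetry; apply vlin_var.
  - symmetry; apply vlin_zero.
  - rewrite IHe1, IHe2. symmetry. apply vlin_add.
  - rewrite IHe, voppE, <- vlin_scal. f_equal. extensionality k. ring.
  - rewrite IHe. symmetry. apply vlin_scal.
Qed.

(** Soundness of the reflection: every term evaluates to the combination of atoms given by its
    coefficients. *)
Lemma veval_eq (l : list V) e e' : vagree l (vcoef e) (vcoef e') -> veval l e = veval l e'.
Proof. intros H. rewrite !veval_vlin. now apply vlin_ext. Qed.
End RVSBasics.

Ltac vmem x l :=
  match l with nil => constr:(false) | x :: _ => constr:(true) | _ :: ?l' => vmem x l' end.
Ltac vatoms t l :=
  lazymatch t with
  | vadd ?a ?b => let l' := vatoms a l in vatoms b l'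
  | vopp ?a => vatoms a l
  | vscal _ ?a => vatoms a l
  | vzero => l
  | ?x => match vmem x l with true => l | false => constr:(x :: l) end
  end.
Ltac vindex x l :=
  match l with
  | x :: _ => constr:(O)
  | _ :: ?l' => let i := vindex x l' in constr:(S i)
  end.
Ltac vreify t l :=
  lazymatch t with
  | vadd ?a ?b => let a' := vreify a l in let b' := vreify b l in constr:(VAdd a' b')
  | vopp ?a => let a' := vreify a l in constr:(VOpp a')
  | vscal ?c ?a => let a' := vreify a l in constr:(VScal c a')
  | vzero => constr:(VZero)
  | ?x => let i := vindex x l in constr:(VVar i)
  end.
(** Separate from [vring] because some coefficient equations need [field] with their own side
    conditions. *)
Ltac vcoefs :=
  lazymatch goal with
  | |- @eq ?T ?a ?b =>
    let V := lazymatch T with car ?V => V end in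
    let l := vatoms a (@nil (car V)) in
    let l := vatoms b l in
    let ea := vreify a l in
    let eb := vreify b l in
    change (veval l ea = veval l eb);
    apply veval_eq;
    cbv beta iota delta [vagree vcoef vidx];
    repeat match goal with |- _ /\ _ => split | |- True => exact I end
  end.
Ltac vring := vcoefs; ring.
Ltac vfield := vcoefs; field; try lra.

(** * Finite sums *)

Section Sums.
Context {V : RVS}.

Lemma vsum_ext n (g h : nat -> V) : (forall i, (i < n)%nat -> g i = h i) -> vsum n g = vsum n h.
Proof.
  induction n; intros H; simpl; auto. rewrite IHn; auto. now rewrite H by lia.
Qed.

Lemma rsum_ext n (g h : nat -> R) : (forall i, (i < n)%nat -> g i = h i) -> rsum n g = rsum n h.
Proof.
  induction n; intros H; simpl; auto. rewrite IHn; auto. now rewrite H by lia.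
Qed.

Lemma vsum_add n (g h : nat -> V) : vsum n (fun i => g i ⊕ h i) = vsum n g ⊕ vsum n h.
Proof. induction n; simpl. vring. rewrite IHn. vring. Qed.

Lemma vsum_scal n a (g : nat -> V) : vsum n (fun i => a ⊙ g i) = a ⊙ vsum n g.
Proof. induction n; simpl. vring. rewrite IHn. vring. Qed.

Lemma rsum_add n (g h : nat -> R) : rsum n (fun i => g i + h i) = rsum n g + rsum n h.
Proof. induction n; simpl. ring. rewrite IHn. ring. Qed.

Lemma rsum_scal n a (g : nat -> R) : rsum n (fun i => a * g i) = a * rsum n g.
Proof. induction n; simpl. ring. rewrite IHn. ring. Qed.

Lemma vsum_const n (c : nat -> R) (a : V) : vsum n (fun i => c i ⊙ a) = rsum n c ⊙ a.
Proof. induction n; simpl. vring. rewrite IHn. vring. Qed.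

Lemma vsum_zero n : vsum n (fun _ => vzero : V) = vzero.
Proof. induction n; simpl; auto. rewrite IHn. vring. Qed.

Lemma vsum_first n (g : nat -> V) : vsum (S n) g = g O ⊕ vsum n (fun i => g (S i)).
Proof.
  induction n. simpl; vring.
  change (vsum (S n) g ⊕ g (S n) = g O ⊕ (vsum n (fun i => g (S i)) ⊕ g (S n))).
  rewrite IHn. vring.
Qed.

Lemma rsum_first n (g : nat -> R) : rsum (S n) g = g O + rsum n (fun i => g (S i)).
Proof.
  induction n. simpl; ring.
  change (rsum (S n) g + g (S n) = g O + (rsum n (fun i => g (S i)) + g (S n))).
  rewrite IHn. ring.
Qed.

Lemma vsum_split n k (g : nat -> V) :
  vsum (n + k) g = vsum n g ⊕ vsum k (fun i => g (n + i)%nat).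
Proof.
  induction k. rewrite Nat.add_0_r. simpl. vring.
  rewrite Nat.add_succ_r. simpl. rewrite IHk. vring.
Qed.

Lemma rsum_split n k (g : nat -> R) :
  rsum (n + k) g = rsum n g + rsum k (fun i => g (n + i)%nat).
Proof.
  induction k. rewrite Nat.add_0_r. simpl. ring.
  rewrite Nat.add_succ_r. simpl. rewrite IHk. ring.
Qed.

Lemma vsum_delta n q (a : V) : (q < n)%nat ->
  vsum n (fun i => if Nat.eqb i q then a else vzero) = a.
Proof.
  induction n; intros H. lia. simpl.
  destruct (Nat.eqb_spec n q).
  - rewrite (vsum_ext _ _ (fun _ => vzero)), vsum_zero. vring.
    intros i Hi. destruct (Nat.eqb_spec i q); auto; lia.
  - rewrite IHn by lia. vring.
Qed.

Lemma rsum_delta n q a : (q < n)%nat ->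
  rsum n (fun i => if Nat.eqb i q then a else 0) = a.
Proof.
  induction n; intros H. lia. simpl.
  destruct (Nat.eqb_spec n q).
  - assert (E : forall k, (k <= q)%nat -> rsum k (fun i => if Nat.eqb i q then a else 0) = 0).
    { induction k; intros; simpl; auto. rewrite IHk by lia.
      destruct (Nat.eqb_spec k q); [lia | ring]. }
    rewrite E by lia. ring.
  - rewrite IHn by lia. ring.
Qed.

Lemma rsum_nonneg n g : (forall i, (i < n)%nat -> 0 <= g i) -> 0 <= rsum n g.
Proof.
  induction n; intros H; simpl. lra.
  specialize (IHn (fun i Hi => H i ltac:(lia))). specialize (H n ltac:(lia)). lra.
Qed.

Lemma rsum_nonneg_zero n g : (forall i, (i < n)%nat -> 0 <= g i) -> rsum n g = 0 ->
  forall i, (i < n)%nat -> g i = 0.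
Proof.
  induction n; intros H E i Hi. lia. simpl in E.
  pose proof (rsum_nonneg n g (fun i Hi => H i ltac:(lia))).
  pose proof (H n ltac:(lia)).
  destruct (Nat.eq_dec i n) as [->|]. lra.
  apply IHn; auto. lra. lia.
Qed.
End Sums.

(** * Independence modulo a subspace *)

Definition lincomb {V : RVS} (n : nat) (c : nat -> R) (x : nat -> V) : V :=
  vsum n (fun i => c i ⊙ x i).

Lemma linear_zero {V W : RVS} (T : V -> W) : linear_map T -> T vzero = vzero.
Proof.
  intros [_ H]. rewrite <- (vscal0l vzero), H. apply vscal0l.
Qed.

Lemma linear_opp {V W : RVS} (T : V -> W) : linear_map T -> forall x, T (vopp x) = vopp (T x).
Proof. intros [_ H] x. now rewrite !voppE, H. Qed.

Lemma linear_lincomb {V W : RVS} (T : V -> W) : linear_map T ->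
  forall n c x, T (lincomb n c x) = lincomb n c (fun i => T (x i)).
Proof.
  intros H n c x. unfold lincomb. induction n; simpl.
  - now apply linear_zero.
  - destruct H as [Ha Hs]. now rewrite Ha, Hs, IHn.
Qed.

Definition subspace {V : RVS} (P : V -> Prop) : Prop :=
  P vzero /\ (forall x y, P x -> P y -> P (x ⊕ y)) /\ (forall a x, P x -> P (a ⊙ x)).

Definition null {V : RVS} : V -> Prop := fun v => v = vzero.

Definition span {V : RVS} (n : nat) (x : nat -> V) : V -> Prop :=
  fun v => exists c, v = lincomb n c x.

(** For a subspace [P] this is linear independence of the classes modulo [P], expressed without
    constructing the quotient; [null] gives ordinary independence. *)
Definition indep_mod {V : RVS} (P : V -> Prop) (n : nat) (x : nat -> V) : Prop :=
  forall c, P (lincomb n c x) -> forall i, (i < n)%nat -> c i = 0.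

Definition snoc {T : Type} (n : nat) (x : nat -> T) (u : T) : nat -> T :=
  fun i => if Nat.eqb i n then u else x i.

Definition cat {T : Type} (n : nat) (x y : nat -> T) : nat -> T :=
  fun i => if Nat.ltb i n then x i else y (i - n)%nat.

Lemma snoc_last {T} n (x : nat -> T) u : snoc n x u n = u.
Proof. unfold snoc. now rewrite Nat.eqb_refl. Qed.

Lemma snoc_lt {T} n (x : nat -> T) u i : (i < n)%nat -> snoc n x u i = x i.
Proof. intros. unfold snoc. destruct (Nat.eqb_spec i n); auto; lia. Qed.

Lemma snoc_forall {T} (P : T -> Prop) n x u : (forall i, (i < n)%nat -> P (x i)) -> P u ->
  forall i, (i < S n)%nat -> P (snoc n x u i).
Proof. intros H Hu i Hi. unfold snoc. destruct (Nat.eqb_spec i n); auto. apply H; lia. Qed.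

Lemma cat_l {T} n (x y : nat -> T) i : (i < n)%nat -> cat n x y i = x i.
Proof. intros. unfold cat. destruct (Nat.ltb_spec i n); auto; lia. Qed.

Lemma cat_r {T} n (x y : nat -> T) i : cat n x y (n + i)%nat = y i.
Proof.
  unfold cat. destruct (Nat.ltb_spec (n + i) n); [lia|]. f_equal; lia.
Qed.

Lemma cat_forall {T} (P : T -> Prop) n k x y : (forall i, (i < n)%nat -> P (x i)) ->
  (forall i, (i < k)%nat -> P (y i)) -> forall i, (i < n + k)%nat -> P (cat n x y i).
Proof.
  intros Hx Hy i Hi. unfold cat. destruct (Nat.ltb_spec i n); [apply Hx | apply Hy]; lia.
Qed.

Lemma finite_choice {T} (t0 : T) n (P : nat -> T -> Prop) :
  (forall i, (i < n)%nat -> exists t, P i t) -> exists f, forall i, (i < n)%nat -> P i (f i).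
Proof.
  induction n; intros H. exists (fun _ => t0). intros; lia.
  destruct IHn as [f Hf]. intros; apply H; lia.
  destruct (H n ltac:(lia)) as [t Ht].
  exists (snoc n f t). intros i Hi. destruct (Nat.eq_dec i n) as [->|].
  now rewrite snoc_last. rewrite snoc_lt by lia. apply Hf; lia.
Qed.

Section Independence.
Context {V : RVS}.
Implicit Types (P E : V -> Prop) (x y z : nat -> V).

Lemma sub_opp P : subspace P -> forall v, P v -> P (vopp v).
Proof. intros (_ & _ & H) v Hv. rewrite voppE. auto. Qed.

Lemma sub_sub P : subspace P -> forall v w, P v -> P w -> P (v ⊖ w).
Proof. intros HP v w Hv Hw. apply HP; auto. now apply sub_opp. Qed.

Lemma sub_lincomb P : subspace P -> forall n c x, (forall i, (i < n)%nat -> P (x i)) ->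
  P (lincomb n c x).
Proof.
  intros (H0 & Ha & Hs) n c x. unfold lincomb.
  induction n; intros H; simpl; auto 10.
Qed.

Lemma sub_null : subspace (@null V).
Proof. unfold null. split; [|split]; intros; subst; auto; vring. Qed.

Lemma lincomb_ext n c c' x x' : (forall i, (i < n)%nat -> c i = c' i) ->
  (forall i, (i < n)%nat -> x i = x' i) -> lincomb n c x = lincomb n c' x'.
Proof. intros H H'. apply vsum_ext. intros. now rewrite H, H'. Qed.

Lemma lincomb_snoc n c x u : lincomb (S n) c (snoc n x u) = lincomb n c x ⊕ c n ⊙ u.
Proof.
  unfold lincomb. simpl. rewrite snoc_last. f_equal. apply vsum_ext.
  intros. now rewrite snoc_lt.
Qed.

Lemma lincomb_cat n k c x y :
  lincomb (n + k) c (cat n x y) = lincomb n c x ⊕ lincomb k (fun i => c (n + i)%nat) y.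
Proof.
  unfold lincomb. rewrite vsum_split. f_equal; apply vsum_ext; intros.
  now rewrite cat_l. now rewrite cat_r.
Qed.

Lemma sub_span n x : subspace (span n x).
Proof.
  split; [|split].
  - exists (fun _ => 0). unfold lincomb.
    rewrite (vsum_ext _ _ (fun _ => vzero)), vsum_zero; auto. intros; vring.
  - intros v w [c ->] [c' ->]. exists (fun i => c i + c' i). unfold lincomb.
    rewrite <- vsum_add. apply vsum_ext. intros; vring.
  - intros a v [c ->]. exists (fun i => a * c i). unfold lincomb.
    rewrite <- vsum_scal. apply vsum_ext. intros; vring.
Qed.

Lemma span_succ n x v : span n x v -> span (S n) x v.
Proof.
  intros [c ->]. exists (snoc n c 0). unfold lincomb; simpl.
  rewrite snoc_last. rewrite (vsum_ext n (fun i => snoc n c 0 i ⊙ x i) (fun i => c i ⊙ x i)).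
  vring. intros; now rewrite snoc_lt.
Qed.

Lemma span_last n x : span (S n) x (x n).
Proof.
  exists (fun i => if Nat.eqb i n then 1 else 0). unfold lincomb.
  rewrite <- (vsum_delta (S n) n (x n)) at 1 by lia. apply vsum_ext. intros i _.
  destruct (Nat.eqb_spec i n); subst; vring.
Qed.

Lemma span_sub P n x : subspace P -> (forall i, (i < n)%nat -> P (x i)) ->
  forall v, span n x v -> P v.
Proof. intros HP H v [c ->]. now apply sub_lincomb. Qed.

Lemma indep_prefix P n n' x : (n' <= n)%nat -> indep_mod P n x -> indep_mod P n' x.
Proof.
  intros Hn H c Hc i Hi.
  rewrite <- (cat_l n' c (fun _ => 0) i Hi). apply H; [|lia].
  replace n with (n' + (n - n'))%nat by lia. unfold lincomb. rewrite vsum_split.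
  rewrite (vsum_ext (n - n') _ (fun _ => vzero)), vsum_zero, vadd0.
  - erewrite vsum_ext. exact Hc. intros; simpl. now rewrite cat_l.
  - intros. rewrite cat_r. vring.
Qed.

(** A relation with nonzero last coefficient could be solved for [u] modulo [P]; so that coefficient
    is zero and the relation only involves [x]. *)
Lemma indep_snoc P n x u : subspace P -> indep_mod P n x ->
  (forall w, span n x w -> ~ P (u ⊖ w)) -> indep_mod P (S n) (snoc n x u).
Proof.
  intros HP Hx Hu c Hc. rewrite lincomb_snoc in Hc.
  assert (E : c n = 0).
  { apply NNPP. intros Hn. apply (Hu (- / c n ⊙ lincomb n c x)).
    - apply sub_span. now exists c.
    - replace (u ⊖ - / c n ⊙ lincomb n c x)
        with (/ c n ⊙ (lincomb n c x ⊕ c n ⊙ u)) by (vfield; auto).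
      now apply HP. }
  intros i Hi. destruct (Nat.eq_dec i n) as [->|]; auto.
  apply Hx; [|lia]. rewrite E in Hc.
  replace (lincomb n c x) with (lincomb n c x ⊕ 0 ⊙ u) by vring. exact Hc.
Qed.

(** Modulo [E] a relation loses its [x] part, so the coefficients of [y] vanish; what is left is a
    relation among the [x] modulo [P]. *)
Lemma indep_cat P E n k x y : subspace E -> (forall v, P v -> E v) ->
  (forall i, (i < n)%nat -> E (x i)) -> indep_mod P n x -> indep_mod E k y ->
  indep_mod P (n + k) (cat n x y).
Proof.
  intros HE HPE HxE Hx Hy c Hc. rewrite lincomb_cat in Hc.
  assert (Ey : forall i, (i < k)%nat -> c (n + i)%nat = 0).
  { apply Hy. set (w := lincomb k _ y) in *.
    replace w with ((lincomb n c x ⊕ w) ⊖ lincomb n c x) by vring.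
    apply sub_sub; auto. now apply sub_lincomb. }
  rewrite (lincomb_ext k _ (fun _ => 0) y y) in Hc; auto.
  unfold lincomb at 2 in Hc. rewrite (vsum_ext k _ (fun _ => vzero)), vsum_zero, vadd0 in Hc
    by (intros; vring).
  intros i Hi. destruct (lt_dec i n). now apply (Hx c Hc).
  replace i with (n + (i - n))%nat by lia. apply Ey; lia.
Qed.

Lemma indep_scale P n x e : (forall i, (i < n)%nat -> e i <> 0) -> indep_mod P n x ->
  indep_mod P n (fun i => e i ⊙ x i).
Proof.
  intros He Hx c Hc i Hi.
  assert (c i * e i = 0).
  { apply (Hx (fun i => c i * e i)); auto. unfold lincomb.
    erewrite vsum_ext. exact Hc. intros; simpl; vring. }
  destruct (Rmult_integral _ _ H); auto. now destruct (He i Hi).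
Qed.

(* Processing the family one vector at a time, [z] collects the vectors that are new modulo [E];
   each other vector is corrected by a combination of [z] into [E] and put into [y]. *)
Lemma indep_chain P E k x : subspace P -> subspace E -> indep_mod P k x ->
  exists s t y z, (s + t = k)%nat /\
    (forall i, (i < s)%nat -> span k x (y i) /\ E (y i)) /\
    (forall i, (i < t)%nat -> span k x (z i)) /\
    indep_mod P s y /\ indep_mod E t z.
Proof.
  intros HP HE. induction k; intros Hx.
  { exists O, O, x, x. repeat split; try lia; intros c _ i Hi; lia. }
  destruct IHk as (s & t & y & z & Hst & Hy & Hz & Iy & Iz).
  { eapply indep_prefix; [|exact Hx]. lia. }
  destruct (classic (exists w, span t z w /\ E (x k ⊖ w))) as [(w & Hw & HwE)|Hn].
  - assert (Sw : span k x w) by (eapply span_sub; eauto using sub_span).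
    exists (S s), t, (snoc s y (x k ⊖ w)), z. split; [lia|]. split; [|split; [|split]]; auto.
    + apply (snoc_forall (fun v => span (S k) x v /\ E v)).
      { intros i Hi. destruct (Hy i Hi). split; auto. now apply span_succ. }
      split; auto. apply sub_sub; auto using sub_span, span_last, span_succ.
    + intros i Hi. apply span_succ; auto.
    + apply indep_snoc; auto. intros v Hv HPv.
      (* Otherwise [x k] would be congruent modulo [P] to a combination of the earlier [x]: a
         relation with coefficient 1 at index [k]. *)
      assert (Sv : span k x (vopp (w ⊕ v))).
      { apply sub_opp; [apply sub_span|]. apply sub_span; auto.
        eapply span_sub; [apply sub_span| |exact Hv]. intros i Hi. now apply Hy. }
      destruct Sv as [c Hc].
      assert (E1 : snoc k c 1 k = 0).
      { apply Hx; [|lia]. unfold lincomb. simpl. rewrite snoc_last.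
        rewrite (vsum_ext k _ (fun i => c i ⊙ x i)) by (intros; now rewrite snoc_lt).
        fold (lincomb k c x). rewrite <- Hc.
        replace (vopp (w ⊕ v) ⊕ 1 ⊙ x k) with (x k ⊖ w ⊖ v) by vring. exact HPv. }
      rewrite snoc_last in E1. lra.
  - exists s, (S t), y, (snoc t z (x k)). split; [lia|]. split; [|split; [|split]]; auto.
    + intros i Hi. destruct (Hy i Hi). split; auto using span_succ.
    + apply (snoc_forall (span (S k) x)); auto using span_last, span_succ.
    + apply indep_snoc; auto. intros v Hv HEv. apply Hn. eauto.
Qed.
End Independence.

Lemma indep_image {V W : RVS} (T : V -> W) (E : W -> Prop) n z : linear_map T ->
  indep_mod (fun v => E (T v)) n z -> indep_mod E n (fun i => T (z i)).
Proof. intros HT Hz c Hc. apply Hz. now rewrite linear_lincomb. Qed.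

Lemma sub_preimage {V W : RVS} (T : V -> W) (E : W -> Prop) : linear_map T -> subspace E ->
  subspace (fun v => E (T v)).
Proof.
  intros HT (H0 & Ha & Hs). split; [|split].
  - now rewrite linear_zero.
  - intros x y. destruct HT as [H _]. rewrite H. auto.
  - intros a x. destruct HT as [_ H]. rewrite H. auto.
Qed.

(** * Rank counting *)

Definition vdim_le (V : RVS) (m : nat) : Prop :=
  forall n (y : nat -> V), indep_mod null n y -> (n <= m)%nat.

(** [indep_chain] splits the [k] vectors into [s] vectors mapped into [DW] and [t] vectors whose
    images are independent modulo [DW]. These images together with [b] are independent in [W], so
    [t + l <= m]. A vector outside [T(DU) + DW] enlarges that family once more, which gains one. *)
Lemma rank_count {U W : RVS} (T : U -> W) (DU P : U -> Prop) (DW : W -> Prop) k l m x b :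
  linear_map T -> subspace DU -> subspace P -> subspace DW -> vdim_le W m ->
  (forall i, (i < k)%nat -> DU (x i)) -> indep_mod P k x ->
  (forall i, (i < l)%nat -> DW (b i)) -> indep_mod null l b ->
  exists s y, (forall i, (i < s)%nat -> DU (y i) /\ DW (T (y i))) /\ indep_mod P s y /\
    (k + l <= s + m)%nat /\
    ((exists w, forall u v, DU u -> DW v -> w <> T u ⊕ v) -> (k + l + 1 <= s + m)%nat).
Proof.
  intros HT HDU HP HDW Hm HxD Hx HbD Hb.
  destruct (indep_chain P (fun u => DW (T u)) k x) as (s & t & y & z & Hst & Hy & Hz & Iy & Iz);
    auto using sub_preimage.
  assert (HzD : forall i, (i < t)%nat -> DU (z i)).
  { intros i Hi. apply (span_sub DU k x); auto. }
  set (g := cat l b (fun i => T (z i))).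
  assert (Ig : indep_mod null (l + t) g).
  { apply indep_cat with DW; auto. now intros v ->; apply HDW. now apply indep_image. }
  exists s, y. split; [|split; [|split]]; auto.
  - intros i Hi. destruct (Hy i Hi). split; auto. now apply (span_sub DU k x).
  - pose proof (Hm _ _ Ig). lia.
  - intros [w Hw].
    assert (I2 : indep_mod null (S (l + t)) (snoc (l + t) g w)).
    { apply indep_snoc; auto using sub_null. intros v [c Hc] Hv.
      unfold g in Hc. rewrite lincomb_cat in Hc.
      apply (Hw (lincomb t (fun i => c (l + i)%nat) z) (lincomb l c b)).
      - now apply sub_lincomb.
      - now apply sub_lincomb.
      - rewrite (linear_lincomb T) by auto. rewrite vaddC, <- Hc. red in Hv.
        replace w with ((w ⊖ v) ⊕ v) by vring. rewrite Hv. vring. }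
    pose proof (Hm _ _ I2). lia.
Qed.

(** A kernel of a functional has codimension at most 1: for two vectors, the coefficients
    [phi (z 1)] and [- phi (z 0)] give a relation, which forces [phi (z 0) = 0], and then [z 0]
    alone lies in the kernel. *)
Lemma indep_functional {V : RVS} (phi : V -> Rsp) n z : linear_map phi ->
  indep_mod (fun v => phi v = 0) n z -> (n <= 1)%nat.
Proof.
  intros Hphi H. destruct (le_lt_dec n 1) as [|Hn]; auto. exfalso.
  assert (H2 : indep_mod (fun v => phi v = 0) 2 z) by (eapply indep_prefix; [|exact H]; lia).
  assert (F : forall c, phi (lincomb 2 c z) = c O * phi (z O) + c 1%nat * phi (z 1%nat)).
  { intros c. rewrite linear_lincomb by auto. unfold lincomb; simpl. ring. }
  assert (E0 : phi (z O) = 0).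
  { assert (E := H2 (fun i => match i with O => phi (z 1%nat) | _ => - phi (z O) end)).
    cbv beta in E. rewrite F in E. specialize (E ltac:(simpl; ring) 1%nat ltac:(lia)). simpl in E. lra. }
  assert (E := H2 (fun i => match i with O => 1 | _ => 0 end)).
  cbv beta in E. rewrite F, E0 in E. specialize (E ltac:(simpl; ring) O ltac:(lia)). simpl in E. lra.
Qed.

(** Adding one coordinate [phi] adds at most one dimension: at most one vector is new modulo the
    kernel of [phi], and [T] embeds that kernel into [W]. *)
Lemma vdim_extend {V W : RVS} (phi : V -> Rsp) (T : V -> W) m :
  linear_map phi -> linear_map T -> vdim_le W m ->
  (forall v, phi v = 0 -> T v = vzero -> v = vzero) -> vdim_le V (S m).
Proof.
  intros Hphi HT Hm Hinj n x Hx.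
  assert (HE : subspace (fun v => phi v = 0)).
  { split; [|split]. now apply linear_zero in Hphi.
    intros u v. destruct Hphi as [Ha _]. rewrite Ha. simpl. lra.
    intros a u. destruct Hphi as [_ Hs]. rewrite Hs. simpl. intros ->. ring. }
  destruct (indep_chain null (fun v => phi v = 0) n x) as (s & t & y & z & Hst & Hy & Hz & Iy & Iz);
    auto using sub_null.
  pose proof (indep_functional phi t z Hphi Iz).
  assert (s <= m)%nat; [|lia].
  apply (Hm s (fun i => T (y i))). intros c Hc. apply Iy.
  apply Hinj.
  - apply sub_lincomb; auto. intros i Hi. now apply Hy.
  - now rewrite linear_lincomb.
Qed.

Lemma vdim_Rn m : vdim_le (Rn m) m.
Proof.
  induction m.
  - intros n y Hy. destruct n; [lia|]. exfalso.
    assert (E : (fun _ : nat => 1) O = 0).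
    { apply (Hy (fun _ => 1)) with (i := O); [|lia]. red. extensionality i. now apply (Fin.case0 (fun i => lincomb (S n) (fun _ => 1) y i = (vzero : Rn 0) i)). }
    simpl in E. lra.
  - apply (@vdim_extend (Rn (S m)) (Rn m) (fun v => v Fin.F1) (fun v i => v (Fin.FS i))); auto.
    + split; reflexivity.
    + split; reflexivity.
    + intros v H0 HS. extensionality i. apply (Fin.caseS' i (fun i => v i = (vzero : Rn (S m)) i)); auto.
      intros k. exact (f_equal (fun g => g k) HS).
Qed.

Lemma linear_fst {V W : RVS} : @linear_map (prodRVS V W) V fst.
Proof. split; reflexivity. Qed.

Lemma linear_snd {V W : RVS} : @linear_map (prodRVS V W) W snd.
Proof. split; reflexivity. Qed.

Lemma vdim_prod_R (W : RVS) m : vdim_le W m -> vdim_le (prodRVS W Rsp) (S m).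
Proof.
  intros H. apply (@vdim_extend (prodRVS W Rsp) W snd fst);
    auto using linear_fst, linear_snd.
  intros [w r]; simpl; intros -> ->; reflexivity.
Qed.

(** * Affine and linear independence *)

Lemma aff_to_lin {V : RVS} n (x : nat -> V) : aff_indep n x ->
  indep_mod null n (fun i => x (S i) ⊖ x O).
Proof.
  intros H c Hc i Hi. red in Hc.
  (* The base point gets the weight that makes the total zero; [n + 1] points correspond to [n]
     differences. *)
  apply (H (fun i => match i with O => - rsum n c | S i => c i end)) with (i := S i); [| |lia].
  - rewrite rsum_first. change (- rsum n c + rsum n c = 0). ring.
  - rewrite vsum_first. cbv beta iota. rewrite <- Hc. unfold lincomb.
    rewrite (vsum_ext n (fun i => c i ⊙ (x (S i) ⊖ x O))
      (fun i => c i ⊙ x (S i) ⊕ c i ⊙ vopp (x O))) by (intros; vring).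
    rewrite vsum_add, vsum_const. vring.
Qed.

Lemma lin_to_aff {V : RVS} n (x0 : V) (u : nat -> V) : indep_mod null n u ->
  aff_indep n (fun i => match i with O => x0 | S i => x0 ⊕ u i end).
Proof.
  intros H c Hs Hv. rewrite rsum_first in Hs. rewrite vsum_first in Hv. cbv beta iota in Hs, Hv.
  rewrite (vsum_ext n _ (fun i => c (S i) ⊙ x0 ⊕ c (S i) ⊙ u i)), vsum_add, vsum_const in Hv
    by (intros; vring).
  assert (E : forall i, (i < n)%nat -> c (S i) = 0).
  { apply (H (fun i => c (S i))). red. rewrite <- Hv. unfold lincomb.
    replace (c O) with (- rsum n (fun i => c (S i))) by lra. vring. }
  intros [|i] Hi; [|apply E; lia].
  rewrite (rsum_ext n _ (fun _ => 0 * 0)), rsum_scal in Hs. lra.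
  intros; rewrite E; auto; ring.
Qed.

(** * Minimal faces and their directions *)

(** The space [D(x,C)] above. [min_face_dir] and [dir_min_face] relate it to the minimal face of
    [x]. *)
Definition dir {V : RVS} (C : V -> Prop) (x v : V) : Prop :=
  exists e, 0 < e /\ C (x ⊕ e ⊙ v) /\ C (x ⊖ e ⊙ v).

(* Two points are related when some open segment contained in [C] contains both. *)
Definition linked {V : RVS} (C : V -> Prop) (x y : V) : Prop :=
  exists e, 0 < e /\ C (x ⊕ e ⊙ (x ⊖ y)) /\ C (y ⊕ e ⊙ (y ⊖ x)).

Lemma Rmin_pos2 a b : 0 < a -> 0 < b -> exists c, 0 < c /\ c <= a /\ c <= b.
Proof.
  intros. exists (Rmin a b). split; [now apply Rmin_glb_lt|].
  split; [apply Rmin_l | apply Rmin_r].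
Qed.

Section Faces.
Context {V : RVS}.
Implicit Types (C F : V -> Prop) (x y z u v w : V).

Lemma convex_mem C x y t z : convex_set C -> C x -> C y -> 0 <= t <= 1 ->
  z = t ⊙ x ⊕ (1 - t) ⊙ y -> C z.
Proof. intros H Hx Hy Ht ->. now apply H. Qed.

Lemma convex_seg C x v s t : convex_set C -> C x -> C (x ⊕ s ⊙ v) -> 0 <= t <= s ->
  C (x ⊕ t ⊙ v).
Proof.
  intros HC Hx Hs Ht. destruct (Req_dec s 0) as [->|Hn].
  - replace t with 0 by lra. replace (x ⊕ 0 ⊙ v) with x by vring. auto.
  - apply (convex_mem C (x ⊕ s ⊙ v) x (t / s)); auto.
    + split. apply Rmult_le_pos; [lra|]. left. apply Rinv_0_lt_compat; lra.
      apply (Rmult_le_reg_r s); [lra|]. field_simplify; lra.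
    + vfield.
Qed.

Lemma dir_le C x v : convex_set C -> dir C x v ->
  exists e, 0 < e /\ forall t, - e <= t <= e -> C (x ⊕ t ⊙ v).
Proof.
  intros HC (e & He & H1 & H2). exists e. split; auto. intros t Ht.
  apply (convex_mem C (x ⊕ e ⊙ v) (x ⊖ e ⊙ v) ((1 + t / e) / 2)); auto.
  - assert (- 1 <= t / e <= 1); [|lra]. split; apply (Rmult_le_reg_r e); auto;
    unfold Rdiv; rewrite ?Rmult_assoc, ?Rinv_l by lra; lra.
  - vfield.
Qed.

Lemma sub_dir C x : convex_set C -> C x -> subspace (dir C x).
Proof.
  intros HC Hx. split; [|split].
  - exists 1. split; [lra|]. split; [replace (x ⊕ 1 ⊙ vzero) with x by vring
    | replace (x ⊖ 1 ⊙ vzero) with x by vring]; auto.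
  - intros u v Hu Hv.
    destruct (dir_le _ _ _ HC Hu) as (e1 & He1 & H1).
    destruct (dir_le _ _ _ HC Hv) as (e2 & He2 & H2).
    destruct (Rmin_pos2 e1 e2) as (e & He & Hle1 & Hle2); auto.
    exists (e / 2). split; [lra|]. split.
    + apply (convex_mem C (x ⊕ e ⊙ u) (x ⊕ e ⊙ v) (/ 2)); auto; try lra.
      apply H1; lra. apply H2; lra. vfield.
    + apply (convex_mem C (x ⊕ (- e) ⊙ u) (x ⊕ (- e) ⊙ v) (/ 2)); auto; try lra.
      apply H1; lra. apply H2; lra. vfield.
  - intros a u Hu. destruct (dir_le _ _ _ HC Hu) as (e & He & H1).
    assert (Ha : 0 < Rabs a + 1) by (pose proof (Rabs_pos a); lra).
    (* The summand 1 covers [a = 0], and [d * a] stays within [[-e, e]]. *)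
    set (d := e / (Rabs a + 1)).
    assert (Hd : 0 < d) by (unfold d; apply Rdiv_lt_0_compat; lra).
    assert (Hda : - e <= d * a <= e).
    { assert (d * (Rabs a + 1) = e) by (unfold d; field; lra).
      destruct (Rcase_abs a) as [h|h]; unfold Rabs in *; destruct (Rcase_abs a); split; nra. }
    exists d. split; [auto|]. split.
    + replace (x ⊕ d ⊙ (a ⊙ u)) with (x ⊕ (d * a) ⊙ u) by vring. auto.
    + replace (x ⊖ d ⊙ (a ⊙ u)) with (x ⊕ (- (d * a)) ⊙ u) by vring. apply H1; lra.
Qed.

Lemma linked_sym C x y : linked C x y -> linked C y x.
Proof. intros (e & He & H1 & H2). exists e. auto. Qed.

Lemma linked_refl C x : C x -> linked C x x.
Proof.
  intros H. exists 1. split; [lra|]. replace (x ⊕ 1 ⊙ (x ⊖ x)) with x by vring. auto.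
Qed.

Lemma linked_mem C x y : convex_set C -> linked C x y -> C y.
Proof.
  intros HC (e & He & H1 & H2).
  apply (convex_mem C (x ⊕ e ⊙ (x ⊖ y)) (y ⊕ e ⊙ (y ⊖ x)) (e / (1 + 2 * e))); auto.
  - split. apply Rmult_le_pos; [lra|]. left. apply Rinv_0_lt_compat; lra.
    apply (Rmult_le_reg_r (1 + 2 * e)); [lra|]. field_simplify; lra.
  - vfield.
Qed.

(** Weights proportional to [1 + d] and [e] cancel [z] and leave a point beyond [x] on the ray from
    [u] through [x]. This is the core of the transitivity of [linked]. *)
Lemma linked_extend C x z u e d : convex_set C -> 0 < e -> 0 < d ->
  C (x ⊕ e ⊙ (x ⊖ z)) -> C (z ⊕ d ⊙ (z ⊖ u)) ->
  exists e', 0 < e' /\ C (x ⊕ e' ⊙ (x ⊖ u)).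
Proof.
  intros HC He Hd H1 H2. exists (e * d / (1 + d + e)). split.
  { apply Rdiv_lt_0_compat; nra. }
  apply (convex_mem C _ _ ((1 + d) / (1 + d + e)) _ HC H1 H2).
  - split. apply Rmult_le_pos; [lra|]. left. apply Rinv_0_lt_compat; lra.
    apply (Rmult_le_reg_r (1 + d + e)); [lra|]. field_simplify; lra.
  - vfield.
Qed.

Lemma linked_intro C x y e d : convex_set C -> C x -> C y -> 0 < e -> 0 < d ->
  C (x ⊕ e ⊙ (x ⊖ y)) -> C (y ⊕ d ⊙ (y ⊖ x)) -> linked C x y.
Proof.
  intros HC Hx Hy He Hd H1 H2. destruct (Rmin_pos2 e d) as (c & Hc & Hce & Hcd); auto.
  exists c. split; auto. split.
  - apply convex_seg with e; auto; lra.
  - apply convex_seg with d; auto; lra.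
Qed.

Lemma linked_trans C x z u : convex_set C -> linked C x z -> linked C z u -> linked C x u.
Proof.
  intros HC Hxz Hzu.
  assert (Cx : C x) by (eapply linked_mem; eauto using linked_sym).
  assert (Cu : C u) by (eapply linked_mem; eauto).
  destruct Hxz as (e & He & H1 & H2), Hzu as (d & Hd & H3 & H4).
  destruct (linked_extend C x z u e d) as (a & Ha & Hxa); auto.
  destruct (linked_extend C u z x d e) as (b & Hb & Hub); auto.
  now apply linked_intro with a b.
Qed.

Lemma linked_seg C x y z u : convex_set C -> subset (open_seg x y) C ->
  open_seg x y z -> open_seg x y u -> linked C z u.
Proof.
  intros HC Hs (t & Ht & ->) (s & Hs' & ->).
  destruct (Rmin_pos2 t (1 - t)) as (a & Ha & Ha1 & Ha2); try lra.
  destruct (Rmin_pos2 s (1 - s)) as (b & Hb & Hb1 & Hb2); try lra.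
  destruct (Rmin_pos2 a b) as (c & Hc & Hca & Hcb); try lra.
  exists c. split; auto. split; apply Hs.
  - exists (t + c * (t - s)). split. split; nra. vring.
  - exists (s + c * (s - t)). split. split; nra. vring.
Qed.

(** Any two points of an open segment contained in [C] are linked, so by transitivity a segment
    meeting the class of [x] lies in it. Being a face through [x], the class contains the minimal
    face. *)
Lemma linked_face C x : convex_set C -> C x -> face (linked C x) C.
Proof.
  intros HC Cx. split; [|split].
  - intros y z t Hy Hz Ht.
    assert (Cy : C y) by (eapply linked_mem; eauto).
    assert (Cz : C z) by (eapply linked_mem; eauto).
    destruct Hy as (e & He & H1 & H2), Hz as (d & Hd & H3 & H4).
    destruct (Rmin_pos2 e d) as (c & Hc & Hce & Hcd); auto.
    exists c. split; auto. split.
    + apply (convex_mem C (x ⊕ c ⊙ (x ⊖ y)) (x ⊕ c ⊙ (x ⊖ z)) t); auto; [| |vring];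
        eapply convex_seg; eauto; lra.
    + apply (convex_mem C (y ⊕ c ⊙ (y ⊖ x)) (z ⊕ c ⊙ (z ⊖ x)) t); auto; [| |vring];
        eapply convex_seg; eauto; lra.
  - intros y Hy. eapply linked_mem; eauto.
  - intros a b _ Hs (z & Hz & Hxz) u Hu.
    apply linked_trans with z; auto. now apply linked_seg with a b.
Qed.

Lemma linked_dir C x y : convex_set C -> linked C x y -> dir C x (y ⊖ x).
Proof.
  intros HC H. assert (Cx : C x) by (eapply linked_mem; eauto using linked_sym).
  assert (Cy : C y) by (eapply linked_mem; eauto).
  destruct H as (e & He & H1 & _). destruct (Rmin_pos2 e 1) as (c & Hc & Hce & Hcd); try lra.
  exists c. split; auto. split.
  - apply convex_seg with 1; auto. replace (x ⊕ 1 ⊙ (y ⊖ x)) with y by vring. auto. lra.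
  - replace (x ⊖ c ⊙ (y ⊖ x)) with (x ⊕ c ⊙ (x ⊖ y)) by vring.
    apply convex_seg with e; auto; lra.
Qed.

Lemma min_face_dir C x y : convex_set C -> C x -> min_face x C y -> dir C x (y ⊖ x).
Proof.
  intros HC Cx H. apply linked_dir; auto. apply H. now apply linked_face.
  now apply linked_refl.
Qed.

(** The open segment from [x - ev] to [x + ev] meets every face through [x], at [x], and so lies in
    it. The half [e / 2] avoids the endpoint; [v = 0] is separate because faces are tested on
    nondegenerate segments. *)
Lemma dir_min_face C x v : convex_set C -> dir C x v ->
  exists e, 0 < e /\ min_face x C (x ⊕ e ⊙ v).
Proof.
  intros HC H. destruct (dir_le _ _ _ HC H) as (e & He & He').
  exists (e / 2). split; [lra|]. intros F (_ & _ & HF) Fx.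
  destruct (classic (v = vzero)) as [->|Hv].
  { replace (x ⊕ (e / 2) ⊙ vzero) with x by vring. auto. }
  apply (HF (x ⊕ (- e) ⊙ v) (x ⊕ e ⊙ v)).
  - intros E. apply Hv. replace v with (/ (2 * e) ⊙ ((x ⊕ e ⊙ v) ⊖ (x ⊕ (- e) ⊙ v))) by vfield.
    rewrite E. vring.
  - intros z (t & Ht & ->).
    replace (t ⊙ (x ⊕ (- e) ⊙ v) ⊕ (1 - t) ⊙ (x ⊕ e ⊙ v)) with (x ⊕ (e - 2 * t * e) ⊙ v) by vring.
    apply He'. nra.
  - exists x. split; auto. exists (/ 2). split; [lra|]. vfield.
  - exists (/ 4). split; [lra|]. vfield.
Qed.

Lemma face_ext C F F' : (forall x, F x <-> F' x) -> face F C -> face F' C.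
Proof.
  intros H (H1 & H2 & H3). split; [|split].
  - intros x y t Hx Hy Ht. apply H, H1; auto; now apply H.
  - intros x Hx. now apply H2, H.
  - intros x y Hn Hs (z & Hz & Fz) u Hu. apply H. apply (H3 x y); auto.
    exists z. split; auto. now apply H.
Qed.

Lemma aff_indep_dir C x n (y : nat -> V) : convex_set C -> C x ->
  (forall i, (i <= n)%nat -> min_face x C (y i)) -> aff_indep n y ->
  forall i, (i < n)%nat -> dir C x (y (S i) ⊖ y O).
Proof.
  intros HC Cx Hy Hi i Hin.
  replace (y (S i) ⊖ y O) with ((y (S i) ⊖ x) ⊖ (y O ⊖ x)) by vring.
  apply sub_sub. now apply sub_dir.
  all: apply min_face_dir; auto; apply Hy; lia.
Qed.
End Faces.

(** * Exchange of extreme points and extreme rays *)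

Definition rdim_le {V : RVS} (D : V -> Prop) (n : nat) : Prop :=
  forall k x, (forall i, (i < k)%nat -> D (x i)) -> indep_mod null k x -> (k <= n)%nat.

(* [r = vzero] encodes an extreme point, [r <> vzero] the point [a ⊕ r] of an extreme ray
   issued from the extreme point [a]. *)
Definition atom {V : RVS} (C : V -> Prop) (a r : V) : Prop :=
  extreme_point a C /\
  (r = vzero \/ r <> vzero /\ subset (open_ray a r) C /\ face (open_ray a r) C).

(** [E] will be an affine subspace confining both the points and the origins of their rays, so that
    its dimension controls the exchange. *)
Definition rep {V : RVS} (C E : V -> Prop) (N : nat) (a r : nat -> V) (lam : nat -> R) (y : V) :=
  (forall i, (i < N)%nat -> atom C (a i) (r i) /\ E (a i) /\ E (a i ⊕ r i)) /\
  conv_comb N (fun i => a i ⊕ r i) lam y.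

Definition skip {T : Type} (q : nat) (g : nat -> T) : nat -> T :=
  fun k => if Nat.ltb k q then g k else g (S k).

Lemma vsum_skip {V : RVS} n q (g : nat -> V) : (q <= n)%nat ->
  vsum (S n) g = g q ⊕ vsum n (skip q g).
Proof.
  intros Hq.
  replace (S n) with (q + S (n - q))%nat by lia. rewrite vsum_split, vsum_first.
  replace (vsum n (skip q g)) with (vsum (q + (n - q)) (skip q g)) by (f_equal; lia).
  rewrite vsum_split, Nat.add_0_r.
  rewrite (vsum_ext q (skip q g) g).
  rewrite (vsum_ext (n - q) (fun i => skip q g (q + i)%nat) (fun i => g (q + S i)%nat)). vring.
  - intros i _. unfold skip. destruct (Nat.ltb_spec (q + i) q); [lia|]. f_equal; lia.
  - intros i Hi. unfold skip. destruct (Nat.ltb_spec i q); auto; lia.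
Qed.

Lemma rsum_vsum n g : rsum n g = @vsum Rsp n g.
Proof. induction n; simpl; auto. now rewrite IHn. Qed.

Lemma rsum_skip n q g : (q <= n)%nat -> rsum (S n) g = g q + rsum n (skip q g).
Proof. intros H. rewrite !rsum_vsum. now apply (@vsum_skip Rsp). Qed.

Lemma dependent {V : RVS} n (x : nat -> V) : ~ indep_mod null n x ->
  exists c, lincomb n c x = vzero /\ exists i, (i < n)%nat /\ c i <> 0.
Proof.
  intros H. apply NNPP. intros Hn. apply H. intros c Hc i Hi. apply NNPP. intros Hci.
  apply Hn. eauto.
Qed.

(** The ratio test of linear programming: among the indices with [g > 0], one where [mu - t * g] is
    zero for the smallest [t]. *)
Lemma ratio_min n (mu g : nat -> R) : (exists i, (i < n)%nat /\ 0 < g i) ->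
  exists i, (i < n)%nat /\ 0 < g i /\
    forall k, (k < n)%nat -> 0 < g k -> mu i / g i <= mu k / g k.
Proof.
  induction n; intros (i & Hi & Hg). lia.
  destruct (classic (exists i, (i < n)%nat /\ 0 < g i)) as [Hex|Hno].
  - destruct (IHn Hex) as (j & Hj & Hgj & Hmin).
    destruct (Rlt_le_dec 0 (g n)) as [Hn|Hn].
    + destruct (Rle_lt_dec (mu j / g j) (mu n / g n)) as [Hle|Hlt].
      * exists j. split; [lia|]. split; auto. intros k Hk Hgk.
        destruct (Nat.eq_dec k n) as [->|]; auto. apply Hmin; auto; lia.
      * exists n. split; [lia|]. split; auto. intros k Hk Hgk.
        destruct (Nat.eq_dec k n) as [->|]; [lra|].
        assert (mu j / g j <= mu k / g k) by (apply Hmin; auto; lia). lra.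
    + exists j. split; [lia|]. split; auto. intros k Hk Hgk.
      destruct (Nat.eq_dec k n) as [->|]; [lra|]. apply Hmin; auto; lia.
  - assert (i = n) as ->. { apply NNPP. intros Hin. apply Hno. exists i. split; auto; lia. }
    exists n. split; auto. split; auto. intros k Hk Hgk.
    destruct (Nat.eq_dec k n) as [->|]; [lra|]. exfalso. apply Hno. exists k. split; auto; lia.
Qed.

Section Reduce.
Context {V : RVS}.
Variables (N q : nat) (p : nat -> V) (a r : V) (lam : nat -> R).
Hypothesis Hq : (q < N)%nat.
Hypothesis Hp : p q = a ⊕ r.
Hypothesis Hlam : forall i, (i < N)%nat -> 0 < lam i.

(** Data relative to the origin [a] of the ray: its direction at [q], displacements elsewhere. A
    relation among these shifts weights and changes the multiple of [r] independently. *)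
Let u i := if Nat.eqb i q then r else p i ⊖ a.
Let off (c : nat -> R) i := if Nat.eqb i q then 0 else c i.

(* The sign condition makes the weight at [q] grow, so it stays positive and the remaining multiple
   of [r] can be absorbed into the point [a ⊕ kap ⊙ r]. *)
Lemma reduce_signed c : lincomb N c u = vzero -> (exists i, (i < N)%nat /\ i <> q /\ c i <> 0) ->
  0 <= rsum N (off c) ->
  exists lam' kap, 0 <= kap /\ (forall i, (i < N)%nat -> 0 <= lam' i) /\
    rsum N lam' = rsum N lam /\
    lincomb N lam' (fun i => if Nat.eqb i q then a ⊕ kap ⊙ r else p i) = lincomb N lam p /\
    ((exists i, (i < N)%nat /\ lam' i = 0) \/ (kap = 0 /\ c q <> 0)).
Proof.
  intros Hc (i0 & Hi0 & Hi0q & Hci0) Hs. set (s := rsum N (off c)) in *.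
  (* The entry at [q] is chosen so that [g] sums to zero; the weights [lam - t * g] then keep their
     total. *)
  set (g := fun i => if Nat.eqb i q then - s else c i).
  assert (Sg : rsum N g = 0).
  { rewrite (rsum_ext N g (fun i => off c i + (if Nat.eqb i q then - s else 0))).
    rewrite rsum_add, rsum_delta by auto. fold s. ring.
    intros i _. unfold g, off. destruct (Nat.eqb i q); ring. }
  assert (gq : g q = - s) by (unfold g; now rewrite Nat.eqb_refl).
  (* If no entry were positive, the zero sum would make all of them vanish, against [c i0 <> 0]. *)
  assert (Hex : exists i, (i < N)%nat /\ 0 < g i).
  { apply NNPP. intros Hn. apply Hci0.
    assert (E : (-1) * g i0 = 0).
    { apply (rsum_nonneg_zero N (fun i => (-1) * g i)); auto.
      - intros i Hi. destruct (Rlt_le_dec 0 (g i)); [exfalso; apply Hn; eauto | lra].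
      - rewrite rsum_scal, Sg. ring. }
    unfold g in E. destruct (Nat.eqb_spec i0 q); [contradiction | lra]. }
  destruct (ratio_min N lam g Hex) as (i1 & Hi1 & Hg1 & Hmin).
  set (t0 := lam i1 / g i1) in *.
  assert (Ht0 : 0 < t0) by (apply Rdiv_lt_0_compat; auto).
  assert (Hlq := Hlam q Hq).
  (* Increase [t] until a weight vanishes, at [t0], or until the remaining multiple
     [lam q - t * c q] of [r] vanishes, whichever comes first. *)
  assert (Ht : exists t, 0 <= t <= t0 /\ 0 <= lam q - t * c q /\
    (t = t0 \/ (lam q - t * c q = 0 /\ c q <> 0))).
  { destruct (Rlt_le_dec 0 (c q)) as [Hcq|Hcq].
    - assert (Hm : lam q / c q * c q = lam q) by (field; lra).
      assert (0 < lam q / c q) by (apply Rdiv_lt_0_compat; auto).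
      destruct (Rle_lt_dec (lam q / c q) t0).
      + exists (lam q / c q). repeat split; try lra.
      + exists t0. repeat split; try lra. nra.
    - exists t0. repeat split; try lra. nra. }
  destruct Ht as (t & Ht & Hnu & Hend).
  set (lam' := fun i => lam i - t * g i).
  assert (Hl'q : 0 < lam' q) by (unfold lam'; rewrite gq; nra).
  exists lam', ((lam q - t * c q) / lam' q). split; [|split; [|split; [|split]]].
  - apply Rmult_le_pos; auto. left. now apply Rinv_0_lt_compat.
  - intros i Hi. unfold lam'. pose proof (Hlam i Hi).
    destruct (Rlt_le_dec 0 (g i)) as [Hgi|Hgi]; [|nra].
    pose proof (Hmin i Hi Hgi). assert (lam i / g i * g i = lam i) by (field; lra). nra.
  - unfold lam'. rewrite (rsum_ext N _ (fun i => lam i + (- t) * g i)) by (intros; ring).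
    rewrite rsum_add, rsum_scal, Sg. ring.
  - unfold lincomb.
    rewrite (vsum_ext N _ (fun i => lam i ⊙ p i ⊕ (- t) ⊙ (c i ⊙ u i ⊕ g i ⊙ a))).
    + rewrite vsum_add, vsum_scal, vsum_add, vsum_const, Sg.
      fold (lincomb N c u). rewrite Hc. vring.
    + intros i _. unfold u. destruct (Nat.eqb_spec i q) as [->|Hn].
      * rewrite Hp. unfold lam' in *. vcoefs; field; lra.
      * unfold lam', g. destruct (Nat.eqb_spec i q); [contradiction|]. vring.
  - destruct Hend as [->|[E Hn]].
    + left. exists i1. split; auto. unfold lam', t0. field. lra.
    + right. split; auto. rewrite E. unfold Rdiv. ring.
Qed.

(** One of the relations [c] and [-c] satisfies the sign condition. *)
Lemma reduce_dependent c : lincomb N c u = vzero ->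
  (exists i, (i < N)%nat /\ i <> q /\ c i <> 0) ->
  exists lam' kap, 0 <= kap /\ (forall i, (i < N)%nat -> 0 <= lam' i) /\
    rsum N lam' = rsum N lam /\
    lincomb N lam' (fun i => if Nat.eqb i q then a ⊕ kap ⊙ r else p i) = lincomb N lam p /\
    ((exists i, (i < N)%nat /\ lam' i = 0) \/ (kap = 0 /\ c q <> 0)).
Proof.
  intros Hc Hex. destruct (Rle_lt_dec 0 (rsum N (off c))) as [Hs|Hs].
  { now apply reduce_signed. }
  destruct (reduce_signed (fun i => (-1) * c i)) as (lam' & kap & H1 & H2 & H3 & H4 & H5).
  - unfold lincomb. rewrite (vsum_ext N _ (fun i => (-1) ⊙ (c i ⊙ u i))) by (intros; vring).
    rewrite vsum_scal. fold (lincomb N c u). rewrite Hc. vring.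
  - destruct Hex as (i & Hi & Hiq & Hci). exists i. repeat split; auto. lra.
  - rewrite (rsum_ext N _ (fun i => (-1) * off c i)). rewrite rsum_scal. lra.
    intros i _. unfold off. destruct (Nat.eqb i q); ring.
  - exists lam', kap. repeat split; auto. destruct H5 as [|[]]; auto. right; split; auto. lra.
Qed.
End Reduce.

(** * Reduction of the number of points *)

Section Caratheodory.
Context {V : RVS}.
Implicit Types (C E D : V -> Prop).

Lemma atom_scale C a r k : 0 <= k -> atom C a r -> atom C a (k ⊙ r).
Proof.
  intros Hk [Ha [->|(Hr & Hs & Hf)]]; split; auto.
  - left. vring.
  - destruct (Req_dec k 0) as [->|Hn]. left; vring. right.
    assert (Hray : forall x, open_ray a r x <-> open_ray a (k ⊙ r) x).
    { intros x; split; intros (t & Ht & ->).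
      - exists (t / k). split. apply Rdiv_lt_0_compat; lra. vcoefs; field; auto.
      - exists (t * k). split. apply Rmult_lt_0_compat; lra. vring. }
    split; [|split].
    + intros E. apply Hr. replace r with (/ k ⊙ (k ⊙ r)) by (vcoefs; field; auto).
      rewrite E. vring.
    + intros x Hx. now apply Hs, Hray.
    + now apply face_ext with (open_ray a r).
Qed.

Lemma rep_drop C E N a r lam y i : rep C E (S N) a r lam y -> (i < S N)%nat -> lam i = 0 ->
  rep C E N (skip i a) (skip i r) (skip i lam) y.
Proof.
  intros (H & Hl & Hs & Hy) Hi Hz. split; [|split; [|split]].
  - intros k Hk. unfold skip. destruct (Nat.ltb k i); apply H; lia.
  - intros k Hk. unfold skip. destruct (Nat.ltb k i); apply Hl; lia.
  - rewrite (rsum_skip N i) in Hs by lia. lra.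
  - rewrite (vsum_skip N i), Hz in Hy by lia. rewrite <- Hy.
    rewrite (vsum_ext N _ (skip i (fun k => lam k ⊙ (a k ⊕ r k)))). vring.
    intros k _. unfold skip. now destruct (Nat.ltb k i).
Qed.

(** Outer induction on the number of points, inner induction on a bound [q] for the indices carrying
    a proper ray point. With more than [k] points and a ray at [q], the vectors of the exchange are
    dependent, so a point disappears or the ray at [q] collapses to its origin. Without rays, the
    classical bound [k + 1] applies. *)
Lemma caratheodory C D y0 k : subspace D -> rdim_le D k ->
  forall N a r lam y, rep C (fun x => D (x ⊖ y0)) N a r lam y ->
  exists N' a' r' lam', rep C (fun x => D (x ⊖ y0)) N' a' r' lam' y /\
    ((N' <= k)%nat \/ (N' <= k + 1)%nat /\ forall i, (i < N')%nat -> r' i = vzero).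
Proof.
  intros HD Hk. set (E := fun x => D (x ⊖ y0)).
  assert (HE : forall x x', E x -> E x' -> D (x ⊖ x')).
  { intros x x' Hx Hx'. replace (x ⊖ x') with ((x ⊖ y0) ⊖ (x' ⊖ y0)) by vring.
    now apply sub_sub. }
  induction N as [|N IHN]; intros a r lam y.
  { intros H. exists O, a, r, lam. split; auto. left; lia. }
  assert (Hzero : forall a r lam, rep C E (S N) a r lam y ->
    (exists i, (i < S N)%nat /\ lam i = 0) ->
    exists N' a' r' lam', rep C E N' a' r' lam' y /\
    ((N' <= k)%nat \/ (N' <= k + 1)%nat /\ forall i, (i < N')%nat -> r' i = vzero)).
  { intros a' r' lam' H (i & Hi & Hz). eapply IHN. eapply rep_drop; eauto. }
  assert (Hq : forall q a r lam, rep C E (S N) a r lam y ->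
    (forall i, (q <= i < S N)%nat -> r i = vzero) ->
    exists N' a' r' lam', rep C E N' a' r' lam' y /\
    ((N' <= k)%nat \/ (N' <= k + 1)%nat /\ forall i, (i < N')%nat -> r' i = vzero)).
  2: { intros H. apply (Hq (S N) a r lam H). intros; lia. }
  clear a r lam. induction q as [|q IHq]; intros a r lam Hrep Hr.
  all: destruct (le_lt_dec (S N) k) as [HNk|HNk]; [exists (S N), a, r, lam; auto|].
  all: destruct (classic (exists i, (i < S N)%nat /\ lam i = 0)) as [Hz|Hz];
    [now apply (Hzero a r lam)|].
  all: assert (Hpos : forall i, (i < S N)%nat -> 0 < lam i) by
    (intros i Hi; destruct Hrep as (_ & Hl & _); destruct (Hl i Hi); auto;
     exfalso; apply Hz; eauto).
  all: destruct Hrep as (Ha & Hl & Hs & Hy); pose proof (conj Ha (conj Hl (conj Hs Hy))) as Hrep;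
    fold (rep C E (S N) a r lam y) in Hrep.
  - destruct (le_lt_dec (S N) (k + 1)) as [HNk1|HNk1].
    { exists (S N), a, r, lam. split; auto. right. split; auto. intros; apply Hr; lia. }
    (* No ray is left, and the [N > k] differences from the last point are dependent. The
       coefficient 0 put at index [N] excludes the outcome of a collapsing ray, so a weight
       vanishes. *)
    destruct (dependent N (fun i => (a i ⊕ r i) ⊖ a N)) as (c & Hc & i0 & Hi0 & Hci0).
    { intros Hi. apply Hk in Hi. lia. intros i Hi'. apply HE; apply Ha; lia. }
    destruct (reduce_dependent (S N) N (fun i => a i ⊕ r i) (a N) (r N) lam) with (c := snoc N c 0)
      as (lam' & kap & H1 & H2 & H3 & H4 & H5); auto.
    + unfold lincomb. simpl. rewrite snoc_last.
      rewrite (vsum_ext N _ (fun i => c i ⊙ ((a i ⊕ r i) ⊖ a N))).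
      fold (lincomb N c (fun i => (a i ⊕ r i) ⊖ a N)). rewrite Hc.
      rewrite Nat.eqb_refl. vring.
      intros i Hi. rewrite snoc_lt by auto. destruct (Nat.eqb_spec i N); [lia|auto].
    + exists i0. rewrite snoc_lt by auto. repeat split; auto; lia.
    + rewrite snoc_last in H5. destruct H5 as [H5|[_ H5]]; [|now destruct H5].
      apply (Hzero a r lam'); auto. split; auto. split; auto. split. now rewrite H3.
      rewrite <- Hy. fold (lincomb (S N) lam (fun i => a i ⊕ r i)). rewrite <- H4.
      unfold lincomb. apply vsum_ext. intros i Hi.
      destruct (Nat.eqb_spec i N) as [->|]; auto. rewrite (Hr N) by lia. vring.
  - destruct (classic ((q < S N)%nat /\ r q <> vzero)) as [[HqN Hrq]|Hn].
    2: { apply (IHq a r lam); auto. intros i Hi.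
         destruct (Nat.eq_dec i q) as [->|]; [|apply Hr; lia].
         apply NNPP. intros Hne. apply Hn. split; auto; lia. }
    set (u := fun i => if Nat.eqb i q then r q else (a i ⊕ r i) ⊖ a q).
    destruct (dependent (S N) u) as (c & Hc & i0 & Hi0 & Hci0).
    { intros Hi. apply Hk in Hi. lia. intros i Hi'. unfold u.
      destruct (Nat.eqb i q).
      - replace (r q) with ((a q ⊕ r q) ⊖ a q) by vring. apply HE; apply Ha; lia.
      - apply HE; apply Ha; lia. }
    (* A relation supported at [q] alone would give [r q = vzero]. *)
    assert (Hex : exists i, (i < S N)%nat /\ i <> q /\ c i <> 0).
    { apply NNPP. intros Hno.
      assert (Hoff : forall i, (i < S N)%nat -> i <> q -> c i = 0).
      { intros i Hi Hiq. apply NNPP. intros Hci. apply Hno. eauto. }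
      destruct (Nat.eq_dec i0 q) as [->|]; [|now apply Hci0, Hoff].
      apply Hrq. replace (r q) with (/ c q ⊙ (c q ⊙ r q)) by (vcoefs; field; auto).
      replace (c q ⊙ r q) with (lincomb (S N) c u). rewrite Hc. vring.
      unfold lincomb. rewrite <- (vsum_delta (S N) q (c q ⊙ r q)) by lia.
      apply vsum_ext. intros i Hi. unfold u. destruct (Nat.eqb_spec i q) as [->|]; auto.
      rewrite Hoff by auto. vring. }
    destruct (reduce_dependent (S N) q (fun i => a i ⊕ r i) (a q) (r q) lam) with (c := c)
      as (lam' & kap & H1 & H2 & H3 & H4 & H5); auto.
    set (r' := fun i => if Nat.eqb i q then kap ⊙ r q else r i).
    assert (Hrep' : rep C E (S N) a r' lam' y).
    { split; [|split; [|split]]; auto.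
      - intros i Hi. destruct (Ha i Hi) as (At & E1 & E2). unfold r'.
        destruct (Nat.eqb_spec i q) as [->|]; [|auto]. split; [now apply atom_scale|].
        split; auto. unfold E. replace (a q ⊕ kap ⊙ r q ⊖ y0)
          with ((a q ⊖ y0) ⊕ kap ⊙ ((a q ⊕ r q) ⊖ a q)) by vring.
        apply HD; auto. apply HD. now apply HE.
      - now rewrite H3.
      - rewrite <- Hy. fold (lincomb (S N) lam (fun i => a i ⊕ r i)). rewrite <- H4.
        unfold lincomb. apply vsum_ext. intros i Hi. unfold r'.
        now destruct (Nat.eqb_spec i q) as [->|]. }
    destruct H5 as [H5|[-> _]].
    + now apply (Hzero a r' lam').
    + apply (IHq a r' lam'); auto. intros i Hi. unfold r'.
      destruct (Nat.eqb_spec i q). vring. apply Hr; lia.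
Qed.
End Caratheodory.

(** * Representation by extreme points and extreme rays *)

Section Klee.
Context {V : RVS} (C : V -> Prop).
Hypothesis HC : convex_set C.
Hypothesis Hclosed : forall x v : V, (forall t, 0 < t <= 1 -> C (x ⊕ t ⊙ v)) -> C x.
Hypothesis Hline : forall x v : V, (forall t, C (x ⊕ t ⊙ v)) -> v = vzero.

Definition recedes (y w : V) : Prop := forall t, 0 <= t -> C (y ⊕ t ⊙ w).

(** Take the supremum of the admissible parameters. By convexity one missing parameter bounds them
    all, and closedness along the segment back to [y] puts the supremum itself in [C]. *)
Lemma exit_point y w : C y -> ~ recedes y w ->
  exists s, 0 <= s /\ C (y ⊕ s ⊙ w) /\ forall s', s < s' -> ~ C (y ⊕ s' ⊙ w).
Proof.
  intros Cy Hn. set (T := fun t => 0 <= t /\ C (y ⊕ t ⊙ w)).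
  assert (T0 : T 0). { split; [lra|]. replace (y ⊕ 0 ⊙ w) with y by vring. auto. }
  assert (Hb : bound T).
  { apply NNPP. intros Hb. apply Hn. intros t Ht. apply NNPP. intros Hct. apply Hb.
    exists t. intros s [Hs Cs]. apply Rnot_lt_le. intros Hlt. apply Hct.
    apply convex_seg with s; auto; lra. }
  destruct (completeness T Hb) as [s [Hub Hlub]]; eauto.
  assert (Hs : 0 <= s) by auto. exists s. split; [|split]; auto.
  - destruct (Req_dec s 0) as [->|Hne]. now apply T0.
    apply Hclosed with ((- s) ⊙ w). intros t Ht.
    replace (y ⊕ s ⊙ w ⊕ t ⊙ ((- s) ⊙ w)) with (y ⊕ ((1 - t) * s) ⊙ w) by vring.
    assert (Hex : exists s', T s' /\ (1 - t) * s < s').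
    { apply NNPP. intros Hno. assert (s <= (1 - t) * s); [|nra].
      apply Hlub. intros s' Hs'. apply Rnot_lt_le. intros Hlt. apply Hno. eauto. }
    destruct Hex as (s' & [_ Cs'] & Hlt). apply convex_seg with s'; auto. split; nra.
  - intros s' Hlt Cs'. assert (s' <= s); [|lra]. apply Hub. split; auto; lra.
Qed.

(** Shrinking a symmetric segment around [a] towards [b] gives a symmetric segment around [y]. *)
Lemma dir_mix a b y v t : C b -> 0 < t <= 1 -> y = t ⊙ a ⊕ (1 - t) ⊙ b ->
  dir C a v -> dir C y v.
Proof.
  intros Cb Ht -> (e & He & H1 & H2). exists (t * e). split. nra. split.
  - apply (convex_mem C (a ⊕ e ⊙ v) b t); auto. lra. vring.
  - apply (convex_mem C (a ⊖ e ⊙ v) b t); auto. lra. vring.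
Qed.

(** [y] lies between [y + sw] and the point [y - ew] of [C], so [dir_mix] applies with weight
    [e / (e + s)]. *)
Lemma dir_exit y w s : dir C y w -> 0 <= s -> forall v, dir C (y ⊕ s ⊙ w) v -> dir C y v.
Proof.
  intros (e & He & H1 & H2) Hs v. apply dir_mix with (y ⊖ e ⊙ w) (e / (e + s)); auto.
  - split. apply Rdiv_lt_0_compat; lra. apply (Rmult_le_reg_r (e + s)); [lra|].
    field_simplify; lra.
  - vfield.
Qed.

Lemma not_dir_exit y w s : (forall s', s < s' -> ~ C (y ⊕ s' ⊙ w)) -> ~ dir C (y ⊕ s ⊙ w) w.
Proof.
  intros H (e & He & H1 & _). apply (H (s + e)). lra.
  replace (y ⊕ (s + e) ⊙ w) with (y ⊕ s ⊙ w ⊕ e ⊙ w) by vring. auto.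
Qed.

(** The strict drop of dimension behind the induction: [w] extends every independent family of
    directions at [z]. *)
Lemma rdim_exit y z w n : C y -> C z -> rdim_le (dir C y) n ->
  (forall v, dir C z v -> dir C y v) -> dir C y w -> ~ dir C z w ->
  exists n', n = S n' /\ rdim_le (dir C z) n'.
Proof.
  intros Cy Cz Hn Hs Hw Hnw.
  assert (K : forall k x, (forall i, (i < k)%nat -> dir C z (x i)) -> indep_mod null k x ->
    (S k <= n)%nat).
  { intros k x Hx Ix. apply (Hn (S k) (snoc k x w)).
    - apply snoc_forall; auto.
    - apply indep_snoc; auto using sub_null. intros v Hv Hwv. apply Hnw.
      replace w with ((w ⊖ v) ⊕ v) by vring. rewrite Hwv.
      replace (vzero ⊕ v) with v by vring. eapply span_sub; eauto. now apply sub_dir. }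
  destruct n as [|n].
  - specialize (K O (fun _ => vzero)). exfalso. assert (1 <= 0)%nat; [|lia].
    apply K. intros; lia. intros c _ i Hi; lia.
  - exists n. split; auto. intros k x Hx Ix. specialize (K k x Hx Ix). lia.
Qed.

Lemma recedes_add y v w : recedes y v -> recedes y w -> recedes y (v ⊕ w).
Proof.
  intros Hv Hw t Ht. apply (convex_mem C (y ⊕ (2 * t) ⊙ v) (y ⊕ (2 * t) ⊙ w) (/ 2)); auto.
  apply Hv; lra. apply Hw; lra. lra. vfield.
Qed.

Lemma recedes_scal y v c : 0 <= c -> recedes y v -> recedes y (c ⊙ v).
Proof.
  intros Hc Hv t Ht. replace (y ⊕ t ⊙ (c ⊙ v)) with (y ⊕ (t * c) ⊙ v) by vring.
  apply Hv. nra.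
Qed.

(* The sets of [s] for which [w + s v], respectively its opposite, recedes are closed half-lines
   covering the line, so they meet; there [C] would contain a line unless [w + s v = 0]. *)
Lemma recedes_one_dim y v w : C y ->
  (forall w, dir C y w -> recedes y w \/ recedes y (vopp w)) ->
  dir C y v -> v <> vzero -> recedes y v -> dir C y w -> exists c, w = c ⊙ v.
Proof.
  intros Cy Hrec Dv Hv Rv Dw.
  assert (Ds : forall s, recedes y (w ⊕ s ⊙ v) \/ recedes y (vopp (w ⊕ s ⊙ v))).
  { intros s. apply Hrec. apply sub_dir; auto. now apply sub_dir. }
  assert (Up : forall s s', s <= s' -> recedes y (w ⊕ s ⊙ v) -> recedes y (w ⊕ s' ⊙ v)).
  { intros s s' Hs R. replace (w ⊕ s' ⊙ v) with ((w ⊕ s ⊙ v) ⊕ (s' - s) ⊙ v) by vring.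
    apply recedes_add; auto. apply recedes_scal; auto; lra. }
  set (L := fun s => ~ recedes y (w ⊕ s ⊙ v)).
  assert (HL : exists s, L s).
  { apply NNPP. intros Hn. apply Hv. apply (Hline (y ⊕ w)). intros s.
    assert (R : recedes y (w ⊕ s ⊙ v)) by (apply NNPP; intros R; apply Hn; now exists s).
    replace (y ⊕ w ⊕ s ⊙ v) with (y ⊕ 1 ⊙ (w ⊕ s ⊙ v)) by vring. apply R; lra. }
  assert (HU : exists s, ~ L s).
  { apply NNPP. intros Hn. apply Hv. apply (Hline (y ⊖ w)). intros s.
    assert (R : recedes y (vopp (w ⊕ (- s) ⊙ v))).
    { destruct (Ds (- s)); auto. exfalso. apply Hn. exists (- s). intros Hl. now apply Hl. }
    replace (y ⊖ w ⊕ s ⊙ v) with (y ⊕ 1 ⊙ vopp (w ⊕ (- s) ⊙ v)) by vring. apply R; lra. }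
  destruct HU as [su Hsu]. apply NNPP in Hsu.
  destruct (completeness L) as [s0 [Hub Hlub]]; auto.
  { exists su. intros s Hs. apply Rnot_lt_le. intros Hlt. apply Hs. apply Up with su; auto; lra. }
  assert (R1 : recedes y (w ⊕ s0 ⊙ v)).
  { intros t Ht. apply Hclosed with (t ⊙ v). intros tau Htau.
    replace (y ⊕ t ⊙ (w ⊕ s0 ⊙ v) ⊕ tau ⊙ (t ⊙ v)) with (y ⊕ t ⊙ (w ⊕ (s0 + tau) ⊙ v)) by vring.
    revert t Ht. change (recedes y (w ⊕ (s0 + tau) ⊙ v)).
    apply NNPP. intros Hn. assert (s0 + tau <= s0) by now apply Hub. lra. }
  assert (R2 : recedes y (vopp (w ⊕ s0 ⊙ v))).
  { intros t Ht. apply Hclosed with (t ⊙ v). intros tau Htau.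
    replace (y ⊕ t ⊙ vopp (w ⊕ s0 ⊙ v) ⊕ tau ⊙ (t ⊙ v))
      with (y ⊕ t ⊙ vopp (w ⊕ (s0 - tau) ⊙ v)) by vring.
    revert t Ht. change (recedes y (vopp (w ⊕ (s0 - tau) ⊙ v))).
    destruct (Ds (s0 - tau)) as [R|]; auto. exfalso.
    assert (s0 <= s0 - tau); [|lra]. apply Hlub. intros s Hs. apply Rnot_lt_le. intros Hlt.
    apply Hs. apply Up with (s0 - tau); auto; lra. }
  exists (- s0). assert (E : w ⊕ s0 ⊙ v = vzero).
  { apply (Hline y). intros t. destruct (Rle_lt_dec 0 t). now apply R1.
    replace (y ⊕ t ⊙ (w ⊕ s0 ⊙ v)) with (y ⊕ (- t) ⊙ vopp (w ⊕ s0 ⊙ v)) by vring.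
    apply R2; lra. }
  replace w with ((w ⊕ s0 ⊙ v) ⊕ (- s0) ⊙ v) by vring. rewrite E. vring.
Qed.

Lemma extreme_of_dir a : C a -> (forall v, dir C a v -> v = vzero) -> extreme_point a C.
Proof.
  intros Ca H. apply face_ext with (linked C a); [|now apply linked_face].
  intros x; split.
  - intros Hx. apply linked_dir in Hx; auto. apply H in Hx.
    replace x with ((x ⊖ a) ⊕ a) by vring. rewrite Hx. vring.
  - intros ->. now apply linked_refl.
Qed.

Lemma extreme_ray_of_dir a v s : 0 < s -> C a -> v <> vzero -> recedes a v ->
  (forall t, t < 0 -> ~ C (a ⊕ t ⊙ v)) -> (forall w, dir C (a ⊕ s ⊙ v) w -> exists c, w = c ⊙ v) ->
  face (open_ray a v) C.
Proof.
  intros Hs Ca Hv Rv Hout Hdir. set (y := a ⊕ s ⊙ v) in *.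
  assert (Cy : C y) by (apply Rv; lra).
  apply face_ext with (linked C y); [|now apply linked_face].
  intros x; split.
  - intros Hx. destruct (Hdir (x ⊖ y)) as [c Hc]. now apply linked_dir.
    assert (Ex : x = a ⊕ (s + c) ⊙ v).
    { replace x with ((x ⊖ y) ⊕ y) by vring. rewrite Hc. unfold y. vring. }
    (* A linked point at parameter [s + c <= 0] could be pushed further from [y], to a negative
       parameter. *)
    exists (s + c). split; auto. apply Rnot_le_lt. intros Hle.
    destruct Hx as (e & He & _ & H2). rewrite Hc, Ex in H2.
    apply (Hout (s + c + e * c)). nra.
    replace (a ⊕ (s + c + e * c) ⊙ v) with (a ⊕ (s + c) ⊙ v ⊕ e ⊙ (c ⊙ v)) by vring. auto.
  (* The step [m / (s + t)] with [m <= s] and [m <= t] keeps both extended parameters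
     nonnegative. *)
  - intros (t & Ht & ->). destruct (Rmin_pos2 s t) as (m & Hm & Hms & Hmt); auto.
    assert (He : 0 < m / (s + t)) by (apply Rdiv_lt_0_compat; lra).
    assert (Hem : m / (s + t) * (s + t) = m) by (field; lra).
    exists (m / (s + t)). set (e := m / (s + t)) in *. split; auto. unfold y. split.
    + replace (a ⊕ s ⊙ v ⊕ e ⊙ (a ⊕ s ⊙ v ⊖ (a ⊕ t ⊙ v))) with (a ⊕ (s + e * (s - t)) ⊙ v)
        by vring. apply Rv. nra.
    + replace (a ⊕ t ⊙ v ⊕ e ⊙ (a ⊕ t ⊙ v ⊖ (a ⊕ s ⊙ v))) with (a ⊕ (t + e * (t - s)) ⊙ v)
        by vring. apply Rv. nra.
Qed.

Lemma rep_single (E : V -> Prop) a r y : atom C a r -> E a -> E (a ⊕ r) -> y = a ⊕ r ->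
  rep C E 1 (fun _ => a) (fun _ => r) (fun _ => 1) y.
Proof.
  intros At Ea Er ->. split; auto. split; [intros; lra|]. split; simpl. ring. vring.
Qed.

Lemma rep_join (E : V -> Prop) N1 a1 r1 l1 z1 N2 a2 r2 l2 z2 y t :
  rep C E N1 a1 r1 l1 z1 -> rep C E N2 a2 r2 l2 z2 -> 0 <= t <= 1 ->
  y = t ⊙ z1 ⊕ (1 - t) ⊙ z2 ->
  rep C E (N1 + N2) (cat N1 a1 a2) (cat N1 r1 r2)
    (cat N1 (fun i => t * l1 i) (fun i => (1 - t) * l2 i)) y.
Proof.
  intros (A1 & L1 & S1 & Y1) (A2 & L2 & S2 & Y2) Ht ->. split; [|split; [|split]].
  - intros i Hi. unfold cat. destruct (Nat.ltb_spec i N1); [apply A1 | apply A2]; lia.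
  - apply cat_forall; intros i Hi; [specialize (L1 i Hi) | specialize (L2 i Hi)]; nra.
  - rewrite rsum_split.
    rewrite (rsum_ext N1 _ (fun i => t * l1 i)) by (intros; now rewrite cat_l).
    rewrite (rsum_ext N2 _ (fun i => (1 - t) * l2 i)) by (intros; now rewrite cat_r).
    rewrite !rsum_scal, S1, S2. ring.
  - rewrite vsum_split.
    rewrite (vsum_ext N1 _ (fun i => t ⊙ (l1 i ⊙ (a1 i ⊕ r1 i))))
      by (intros; rewrite !cat_l by auto; vring).
    rewrite (vsum_ext N2 _ (fun i => (1 - t) ⊙ (l2 i ⊙ (a2 i ⊕ r2 i))))
      by (intros; rewrite !cat_r; vring).
    now rewrite !vsum_scal, Y1, Y2.
Qed.

Lemma rep_mono (E E' : V -> Prop) N a r l y : (forall x, E x -> E' x) ->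
  rep C E N a r l y -> rep C E' N a r l y.
Proof.
  intros H [A Y]. split; auto. intros i Hi. destruct (A i Hi) as (A1 & A2 & A3). auto.
Qed.

(** If some direction [w] recedes neither forwards nor backwards, [y] lies between two exit points
    with smaller direction spaces, and their representations are joined. The new points stay in
    [y + D(y,C)] because directions at an exit point are directions at [y]. *)
Lemma klee_rep n : forall y, C y -> rdim_le (dir C y) n ->
  exists N a r lam, rep C (fun x => dir C y (x ⊖ y)) N a r lam y.
Proof.
  induction n as [n IH] using (well_founded_induction lt_wf). intros y Cy Hn.
  assert (Dsub : subspace (dir C y)) by now apply sub_dir.
  assert (D0 : dir C y (y ⊖ y)) by (replace (y ⊖ y) with (@vzero V) by vring; apply Dsub).
  destruct (classic (exists w, dir C y w /\ ~ recedes y w /\ ~ recedes y (vopp w)))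
    as [(w & Dw & N1 & N2)|Hno].
  - assert (Dw' : dir C y (vopp w)) by now apply sub_opp.
    assert (Z : forall w, dir C y w -> ~ recedes y w -> exists s N a r lam, 0 < s /\
      rep C (fun x => dir C y (x ⊖ y)) N a r lam (y ⊕ s ⊙ w)).
    { clear w Dw N1 N2 Dw'. intros w Dw Nw.
      destruct (exit_point y w) as (s & Hs & Cs & Hout); auto.
      assert (Hz : forall v, dir C (y ⊕ s ⊙ w) v -> dir C y v) by now apply dir_exit.
      destruct (rdim_exit y (y ⊕ s ⊙ w) w n) as (n' & -> & Hn'); auto using not_dir_exit.
      destruct (IH n' ltac:(lia) _ Cs Hn') as (N & a & r & lam & Hrep).
      exists s, N, a, r, lam. split.
      - destruct Dw as (e & He & H1 & _). apply Rnot_le_lt. intros Hle.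
        apply (Hout e); auto; lra.
      - eapply rep_mono; [|exact Hrep]. intros x Hx; simpl in *.
        replace (x ⊖ y) with ((x ⊖ (y ⊕ s ⊙ w)) ⊕ s ⊙ w) by vring.
        apply Dsub; auto. now apply Dsub. }
    destruct (Z w Dw N1) as (s1 & M1 & a1 & r1 & l1 & Hs1 & Rep1).
    destruct (Z _ Dw' N2) as (s2 & M2 & a2 & r2 & l2 & Hs2 & Rep2).
    exists (M1 + M2)%nat. do 3 eexists.
    apply (rep_join _ _ _ _ _ _ _ _ _ _ _ y (s2 / (s1 + s2)) Rep1 Rep2).
    + split. left; apply Rdiv_lt_0_compat; lra.
      apply (Rmult_le_reg_r (s1 + s2)); [lra|]. field_simplify; lra.
    + vfield.
  (* Every direction now recedes on at least one side. Either the directions form a line and [y] is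
     on an extreme ray issued from the exit point [a], or there is no nonzero direction and [y] is
     extreme. *)
  - assert (Hrec : forall w, dir C y w -> recedes y w \/ recedes y (vopp w)).
    { intros w Dw. apply NNPP. intros Hn'. apply Hno. exists w. tauto. }
    destruct (classic (exists v, dir C y v /\ v <> vzero /\ recedes y v)) as [(v & Dv & Hv & Rv)|Htriv].
    + assert (H1 : forall w, dir C y w -> exists c, w = c ⊙ v)
        by (intros w; now apply recedes_one_dim).
      assert (Nv : ~ recedes y (vopp v)).
      { intros R. apply Hv. apply (Hline y). intros t. destruct (Rle_lt_dec 0 t). now apply Rv.
        replace (y ⊕ t ⊙ v) with (y ⊕ (- t) ⊙ vopp v) by vring. apply R; lra. }
      destruct (exit_point y (vopp v)) as (s & Hs & Cs & Hout); auto.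
      assert (Dv' : dir C y (vopp v)) by now apply sub_opp.
      set (a := y ⊕ s ⊙ vopp v) in *.
      assert (Ey : y = a ⊕ s ⊙ v) by (unfold a; vring).
      assert (Hs0 : 0 < s).
      { destruct Dv' as (e & He & Hp & _). apply Rnot_le_lt. intros Hle.
        apply (Hout e); auto; lra. }
      assert (Hneg : forall t, t < 0 -> ~ C (a ⊕ t ⊙ v)).
      { intros t Ht Ca. apply (Hout (s - t)). lra.
        replace (y ⊕ (s - t) ⊙ vopp v) with (a ⊕ t ⊙ v) by (unfold a; vring). auto. }
      assert (Ra : recedes a v).
      { intros t Ht. destruct (Rle_lt_dec s t).
        - replace (a ⊕ t ⊙ v) with (y ⊕ (t - s) ⊙ v) by (unfold a; vring). apply Rv; lra.
        - apply convex_seg with s; auto. now rewrite <- Ey. lra. }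
      assert (Hext : extreme_point a C).
      { apply extreme_of_dir; auto. intros w Dw.
        destruct (H1 w) as [c ->]. { apply (dir_exit y (vopp v) s); auto. }
        destruct (Req_dec c 0) as [->|Hc]. vring.
        exfalso. apply (not_dir_exit y (vopp v) s); auto. fold a.
        replace (vopp v) with ((- / c) ⊙ (c ⊙ v)) by (vcoefs; field; auto).
        now apply sub_dir. }
      do 4 eexists. apply (rep_single (fun x => dir C y (x ⊖ y)) a (s ⊙ v) y).
      * apply atom_scale; [lra|]. split; auto. right. split; auto. split.
        { intros x (t & Ht & ->). apply Ra; lra. }
        apply extreme_ray_of_dir with s; auto. now rewrite <- Ey.
      * unfold a. replace (y ⊕ s ⊙ vopp v ⊖ y) with (s ⊙ vopp v) by vring. now apply Dsub.
      * now rewrite <- Ey.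
      * auto.
    + do 4 eexists. apply (rep_single (fun x => dir C y (x ⊖ y)) y vzero y).
      * split; auto. apply extreme_of_dir; auto. intros v Dv. apply NNPP. intros Hv.
        destruct (Hrec v Dv); apply Htriv; [exists v; auto|].
        exists (vopp v). split; [now apply sub_opp|]. split; auto.
        intros E. apply Hv. replace v with (vopp (vopp v)) by vring. rewrite E. vring.
      * auto.
      * now replace (y ⊕ vzero ⊖ y) with (y ⊖ y) by vring.
      * vring.
Qed.

Lemma klee_face_bound y k : C y ->
  (forall n x, (forall i, (i < n)%nat -> dir C y (x i)) -> indep_mod null n x ->
    (Z.of_nat n <= k)%Z) ->
  face_bound y C k.
Proof.
  intros Cy Hk.
  (* The empty family shows that the integer [k] is nonnegative, so [Z.to_nat k] is faithful. *)
  assert (Hk0 : (0 <= k)%Z).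
  { apply (Hk O (fun _ => vzero)). intros; lia. intros c _ i Hi; lia. }
  assert (Dsub : subspace (dir C y)) by now apply sub_dir.
  split.
  - exists (linked C y). split; [now apply linked_face|]. split; [now apply linked_refl|].
    intros n x Hx Ix. apply (Hk n (fun i => x (S i) ⊖ x O)).
    + intros i Hi. replace (x (S i) ⊖ x O) with ((x (S i) ⊖ y) ⊖ (x O ⊖ y)) by vring.
      apply sub_sub; auto; apply linked_dir; auto; apply Hx; lia.
    + now apply aff_to_lin.
  - assert (Hd : rdim_le (dir C y) (Z.to_nat k)).
    { intros n x Hx Ix. specialize (Hk n x Hx Ix). lia. }
    destruct (klee_rep _ y Cy Hd) as (N & a & r & lam & Hrep).
    destruct (caratheodory C (dir C y) y _ Dsub Hd N a r lam y Hrep)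
      as (N' & a' & r' & lam' & [At Hy] & [HN|[HN Hr]]).
    + right. exists N', (fun i => a' i ⊕ r' i), lam'. split; [lia|]. split; auto.
      intros i Hi. destruct (At i Hi) as ((He & [Hz|(Hz & Hs & Hf)]) & _).
      * left. rewrite Hz. now replace (a' i ⊕ vzero) with (a' i) by vring.
      * right. exists (a' i), (r' i). split; auto. split; auto. split; auto.
        exists 1. split; [lra|]. vring.
    + left. exists N', (fun i => a' i ⊕ r' i), lam'. split; [lia|]. split; auto.
      intros i Hi. rewrite (Hr i Hi). replace (a' i ⊕ vzero) with (a' i) by vring.
      now apply At.
Qed.
End Klee.

(** * Quotient by the lineality space *)

Lemma linearly_closed_seg {V : RVS} (C : V -> Prop) : linearly_closed C ->
  forall x v : V, (forall t, 0 < t <= 1 -> C (x ⊕ t ⊙ v)) -> C x.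
Proof.
  intros Hcl x v H. apply NNPP. intros Hn.
  destruct (Hcl x v 0) as [d Hd].
  { intros E. apply Hn. now replace x with (x ⊕ 0 ⊙ v) by vring. }
  destruct (Rmin_pos2 (d / 2) 1) as (t & Ht & Htd & Ht1).
  { pose proof (cond_pos d); lra. } { lra. }
  apply (Hd t); [|apply H; lra].
  unfold disc. rewrite Rminus_0_r, Rabs_right by lra. pose proof (cond_pos d); lra.
Qed.

Section Quotient.
Context {V Q : RVS} (A : V -> Prop) (q : V -> Q) (p : V).
Hypothesis HA : convex_set A.
Hypothesis Hcl : linearly_closed A.
Hypothesis Ap : A p.
Hypothesis Hq : linear_map q.
Hypothesis Hsurj : surjective_map q.
Hypothesis Hker : forall u, q u = vzero <-> lineality A u.

(** [A] is invariant under the kernel of [q], hence equal to the preimage of its image; this carries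
    properties of [A] over to the quotient. *)
Lemma image_saturated u : image q A (q u) <-> A u.
Proof.
  split; [|intros; now exists u]. intros (u' & Hu' & E).
  assert (K : lineality A (u ⊖ u')).
  { apply Hker. rewrite (proj1 Hq), (linear_opp q Hq), E. vring. }
  replace u with (u' ⊕ 1 ⊙ (u ⊖ u')) by vring. now apply K.
Qed.

Lemma map_line u w t : q u ⊕ t ⊙ q w = q (u ⊕ t ⊙ w).
Proof. destruct Hq as [Ha Hs]. now rewrite Ha, Hs. Qed.

Lemma image_convex : convex_set (image q A).
Proof.
  intros x y t (u & Hu & <-) (w & Hw & <-) Ht.
  exists (t ⊙ u ⊕ (1 - t) ⊙ w). split. now apply HA.
  destruct Hq as [Ha Hs]. now rewrite Ha, !Hs.
Qed.

Lemma image_closed x v : (forall t, 0 < t <= 1 -> image q A (x ⊕ t ⊙ v)) -> image q A x.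
Proof.
  destruct (Hsurj x) as [u <-], (Hsurj v) as [w <-]. intros H.
  apply image_saturated. apply (linearly_closed_seg A Hcl u w).
  intros t Ht. apply image_saturated. rewrite <- map_line. auto.
Qed.

(** A line in the quotient lifts to a line in [A] of direction [w]. Convexity and closedness
    transport it to every point of [A], so [w] lies in the lineality space. *)
Lemma image_no_line x v : (forall t, image q A (x ⊕ t ⊙ v)) -> v = vzero.
Proof.
  destruct (Hsurj x) as [u <-], (Hsurj v) as [w <-]. intros H. apply Hker.
  (* Mixing [u + (t/s)w] and [y] with weight [s] gives [y + tw + s(u - y)], which tends to
     [y + tw]. *)
  intros y t Ay. apply (linearly_closed_seg A Hcl _ (u ⊖ y)). intros s Hs.
  apply (convex_mem A (u ⊕ (t / s) ⊙ w) y s); auto; try lra.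
  - apply image_saturated. rewrite <- map_line. auto.
  - vfield.
Qed.

Lemma quotient_face_bound k :
  (forall n v, (forall i, (i < n)%nat -> dir A p (v i)) -> indep_mod (lineality A) n v ->
    (Z.of_nat n <= k)%Z) ->
  face_bound (q p) (image q A) k.
Proof.
  intros Hk. apply klee_face_bound.
  - apply image_convex.
  - apply image_closed.
  - apply image_no_line.
  - now apply image_saturated.
  - intros n x Hx Ix.
    destruct (finite_choice vzero n (fun i v => q v = x i)) as [v Hv].
    { intros i _. apply Hsurj. }
    apply (Hk n v).
    + intros i Hi. destruct (Hx i Hi) as (e & He & H1 & H2). rewrite <- Hv in H1, H2 by auto.
      exists e. split; auto. rewrite map_line in H1.
      replace (q p ⊖ e ⊙ q (v i)) with (q p ⊕ (- e) ⊙ q (v i)) in H2 by vring.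
      rewrite map_line in H2. apply image_saturated in H1, H2. split; auto.
      now replace (p ⊖ e ⊙ v i) with (p ⊕ (- e) ⊙ v i) by vring.
    + intros c Hc. apply Ix. apply Hker in Hc. rewrite linear_lincomb in Hc by auto.
      red. rewrite <- Hc. apply lincomb_ext; auto. intros; now rewrite Hv.
Qed.
End Quotient.

Lemma sub_lineality {V : RVS} (A : V -> Prop) : subspace (lineality A).
Proof.
  split; [|split].
  - intros x t Ax. now replace (x ⊕ t ⊙ vzero) with x by vring.
  - intros u v Hu Hv x t Ax. replace (x ⊕ t ⊙ (u ⊕ v)) with (x ⊕ t ⊙ u ⊕ t ⊙ v) by vring. auto.
  - intros a u Hu x t Ax. replace (x ⊕ t ⊙ (a ⊙ u)) with (x ⊕ (t * a) ⊙ u) by vring. auto.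
Qed.

Lemma lineality_dir {V : RVS} (A : V -> Prop) p v : A p -> lineality A v -> dir A p v.
Proof.
  intros Ap Hv. exists 1. split; [lra|]. split; auto.
  replace (p ⊖ 1 ⊙ v) with (p ⊕ (- (1)) ⊙ v) by vring. auto.
Qed.

(** Rescaling each direction places [p + e y] in the minimal face and preserves independence; with
    [p] this makes [n + 1] affinely independent images. *)
Lemma quotient_dir_bound {V Q : RVS} (C P : V -> Prop) (q : V -> Q) p j n y :
  convex_set C -> C p -> linear_map q -> (forall u, q u = vzero <-> P u) ->
  affdim (image q (min_face p C)) j ->
  (forall i, (i < n)%nat -> dir C p (y i)) -> indep_mod P n y -> (n <= j)%nat.
Proof.
  intros HC Cp Hq Hker [_ Hj] Hy Iy.
  destruct (finite_choice 0 n (fun i e => 0 < e /\ min_face p C (p ⊕ e ⊙ y i))) as [e He].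
  { intros i Hi. now apply dir_min_face; auto. }
  apply (Hj n (fun i => match i with O => q p | S i => q p ⊕ e i ⊙ q (y i) end)).
  - intros [|i] Hi.
    + exists p. split; auto. now intros F _ Fp.
    + exists (p ⊕ e i ⊙ y i). split. apply He; lia.
      destruct Hq as [Ha Hs]. now rewrite Ha, Hs.
  - apply (lin_to_aff n (q p) (fun i => e i ⊙ q (y i))). apply indep_scale.
    + intros i Hi E. destruct (He i Hi). lra.
    + intros c Hc. apply Iy. apply Hker. now rewrite linear_lincomb.
Qed.

(** * Convexity of level sets, epigraphs and hypographs; obliqueness *)

Lemma lev_convex {V : RVS} (g : V -> ereal) x r : convex_fun g -> g x = EFin r ->
  convex_set (lev g x).
Proof.
  unfold lev. intros Hg E u v t Hu Hv Ht. rewrite E in *.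
  replace r with (t * r + (1 - t) * r) by ring. now apply Hg.
Qed.

Lemma epi_convex {V : RVS} (g : V -> ereal) : convex_fun g -> convex_set (epi g).
Proof. intros Hg [u a] [v b] t Hu Hv Ht. now apply Hg. Qed.

Lemma hypo_mem {V : RVS} (g : V -> ereal) M w r :
  hypo_Mminus M g (w, r) <-> ele (g w) (EFin (M - r)).
Proof.
  unfold hypo_Mminus; simpl. destruct (g w); simpl; split; auto; lra.
Qed.

Lemma hypo_convex {V : RVS} (g : V -> ereal) M : convex_fun g -> convex_set (hypo_Mminus M g).
Proof.
  intros Hg [u a] [v b] t Hu Hv Ht. apply hypo_mem in Hu, Hv. apply hypo_mem. simpl.
  replace (M - (t * a + (1 - t) * b)) with (t * (M - a) + (1 - t) * (M - b)) by ring.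
  now apply Hg.
Qed.

(** If all directions were horizontal, the minimal face and then its affine hull would stay at
    height [r]. *)
Lemma oblique_dir {X : RVS} (x : X) r (C : prodRVS X Rsp -> Prop) :
  convex_set C -> C (x, r) -> oblique x r C -> exists v s, s <> 0 /\ dir C (x, r) (v, s).
Proof.
  intros HC Cx Ho. apply NNPP. intros Hn. apply Ho.
  intros z (n & y & lam & Hy & Hs & <-).
  assert (H : forall i, (i < n)%nat -> snd (y i) = r).
  { intros i Hi. apply NNPP. intros Hne. apply Hn.
    exists (fst (y i) ⊖ x), (snd (y i) - r). split. lra.
    exact (min_face_dir C (x, r) (y i) HC Cx (Hy i Hi)). }
  change (snd (lincomb n lam y) = r). rewrite (linear_lincomb (snd : prodRVS X Rsp -> Rsp) linear_snd).
  unfold lincomb. rewrite (vsum_ext n _ (fun i => lam i ⊙ (r : Rsp))).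
  - rewrite vsum_const, Hs. simpl. ring.
  - intros i Hi. now rewrite H.
Qed.

(** * Directions at a minimizer *)

Section Main.
Context {V : RVS} {m : nat} (Rf : V -> ereal) (f : Rn m -> ereal) (Phi : V -> Rn m) (p : V).
Context {Q1 Q2 : RVS} (q1 : V -> Q1) (q2 : V -> Q2) (j d l : nat) (rp fp : R).

Let S : V -> Prop :=
  fun u => forall v, ele (eadd (Rf u) (f (Phi u))) (eadd (Rf v) (f (Phi v))).
Let K : V -> Prop := lineality (lev Rf p).
Let L : V -> Prop := fun u => Phi u = vzero.
Let KL : V -> Prop := fun u => K u /\ L u.

Hypothesis HR : convex_fun Rf.
Hypothesis Hf : convex_fun f.
Hypothesis HPhi : linear_map Phi.
Hypothesis HS : S p.
Hypothesis Erp : Rf p = EFin rp.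
Hypothesis Efp : f (Phi p) = EFin fp.
Hypothesis Hq1 : linear_map q1.
Hypothesis Hker1 : forall u, q1 u = vzero <-> KL u.
Hypothesis Hd : affdim (image Phi K) d.
Hypothesis Hl : affdim (min_face (Phi p) (lev f (Phi p))) l.
Hypothesis Hj : affdim (image q1 (min_face p S)) j.

(** Phrased with real upper bounds of the two terms, to spare later case distinctions on infinite
    values. *)
Lemma optimal u a b : ele (Rf u) (EFin a) -> ele (f (Phi u)) (EFin b) -> rp + fp <= a + b.
Proof.
  intros Ha Hb. pose proof (HS u) as H. rewrite Erp, Efp in H.
  destruct (Rf u), (f (Phi u)); simpl in *; try contradiction; lra.
Qed.

Lemma minimizer_intro u a b : ele (Rf u) (EFin a) -> ele (f (Phi u)) (EFin b) ->
  a + b <= rp + fp -> S u.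
Proof.
  intros Ha Hb H v. pose proof (HS v) as Hv. rewrite Erp, Efp in Hv.
  destruct (Rf u), (f (Phi u)); simpl in *; try contradiction.
  destruct (Rf v), (f (Phi v)); simpl in *; auto. lra.
Qed.

Lemma minimizer_elim u : S u -> exists a b, ele (Rf u) (EFin a) /\ ele (f (Phi u)) (EFin b) /\
  a + b <= rp + fp.
Proof.
  intros Hu. pose proof (Hu p) as H. rewrite Erp, Efp in H.
  destruct (Rf u) as [a|], (f (Phi u)) as [b|]; simpl in *; try contradiction.
  exists a, b. simpl. repeat split; lra.
Qed.

Lemma minimizers_convex : convex_set S.
Proof.
  intros u v t Hu Hv Ht.
  destruct (minimizer_elim u Hu) as (a & b & Ha & Hb & Hab).
  destruct (minimizer_elim v Hv) as (a' & b' & Ha' & Hb' & Hab').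
  apply minimizer_intro with (t * a + (1 - t) * a') (t * b + (1 - t) * b').
  - now apply HR.
  - destruct HPhi as [Pa Ps]. rewrite Pa, !Ps. now apply Hf.
  - nra.
Qed.

Lemma levR_iff u : lev Rf p u <-> ele (Rf u) (EFin rp).
Proof. unfold lev. now rewrite Erp. Qed.

Lemma levf_iff w : lev f (Phi p) w <-> ele (f w) (EFin fp).
Proof. unfold lev. now rewrite Efp. Qed.

Lemma Phi_line u v t : Phi (u ⊕ t ⊙ v) = Phi u ⊕ t ⊙ Phi v.
Proof. destruct HPhi as [Pa Ps]. now rewrite Pa, Ps. Qed.

Let A := lev Rf p.
Let B := lev f (Phi p).

Lemma levR_convex : convex_set A.
Proof. now apply lev_convex with rp. Qed.

Lemma levf_convex : convex_set B.
Proof. now apply lev_convex with fp. Qed.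

Lemma levR_self : A p.
Proof. apply levR_iff. rewrite Erp. simpl. lra. Qed.

Lemma levf_self : B (Phi p).
Proof. apply levf_iff. rewrite Efp. simpl. lra. Qed.

Lemma sub_KL : subspace KL.
Proof.
  destruct (sub_lineality A) as (K0 & Ka & Ks), HPhi as [Pa Ps].
  split; [|split].
  - split; auto. now apply linear_zero.
  - intros x y [Kx Lx] [Ky Ly]. split; [now apply Ka|]. red in Lx, Ly |- *.
    rewrite Pa, Lx, Ly. vring.
  - intros a x [Kx Lx]. split; [now apply Ks|]. red in Lx |- *. rewrite Ps, Lx. vring.
Qed.

(** Differences of affinely independent points of [Phi(K)] are lifted to [K]; their independent
    images give independence modulo the kernel of [Phi]. *)
Lemma fiber_family : exists c : nat -> V, (forall i, (i < d)%nat -> K (c i)) /\ indep_mod KL d c.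
Proof.
  destruct Hd as [(x & Hx & Ix) _].
  destruct (finite_choice vzero d (fun i c => K c /\ Phi c = x (Datatypes.S i) ⊖ x O)) as [c Hc].
  { intros i Hi. destruct (Hx (Datatypes.S i)) as (u & Ku & <-). lia.
    destruct (Hx O) as (v & Kv & <-). lia.
    exists (u ⊖ v). split. apply (sub_sub K); auto. apply sub_lineality.
    now rewrite (proj1 HPhi), (linear_opp Phi HPhi). }
  exists c. split. intros; now apply Hc.
  intros lam [_ HL] i Hi. apply (aff_to_lin d x Ix lam); auto.
  red in HL. rewrite linear_lincomb in HL by auto. red. rewrite <- HL.
  apply lincomb_ext; auto. intros k Hk. symmetry. now apply Hc.
Qed.

(** Passing from independence modulo [K] to independence modulo [KL] gains the [d] directions inside
    [K]; this is the source of [- d] in the bound. *)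
Lemma lifted_family n v : (forall i, (i < n)%nat -> dir A p (v i)) -> indep_mod K n v ->
  exists x, (forall i, (i < d + n)%nat -> dir A p (x i)) /\ indep_mod KL (d + n) x.
Proof.
  intros Hv Iv. destruct fiber_family as (c & Kc & Ic).
  exists (cat d c v). split.
  - apply cat_forall; auto. intros i Hi. apply lineality_dir. apply levR_self. now apply Kc.
  - apply indep_cat with K; auto. apply sub_lineality. now intros u [].
Qed.

Lemma level_family : exists b, (forall i, (i < l)%nat -> dir B (Phi p) (b i)) /\
  indep_mod null l b.
Proof.
  destruct Hl as [(x & Hx & Ix) _]. exists (fun i => x (Datatypes.S i) ⊖ x O). split.
  - apply aff_indep_dir; auto using levf_convex, levf_self.
  - now apply aff_to_lin.
Qed.

Lemma dir_minimizers v : dir A p v -> dir B (Phi p) (Phi v) -> dir S p v.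
Proof.
  intros HA HB. destruct (dir_le _ _ _ levR_convex HA) as (a & Ha & HA').
  destruct (dir_le _ _ _ levf_convex HB) as (b & Hb & HB').
  destruct (Rmin_pos2 a b) as (e & He & Hea & Heb); auto.
  assert (H : forall t, - e <= t <= e -> S (p ⊕ t ⊙ v)).
  { intros t Ht. apply minimizer_intro with rp fp; [| |lra].
    - apply levR_iff. apply HA'. lra.
    - apply levf_iff. rewrite Phi_line. apply HB'. lra. }
  exists e. split; auto. split. apply H; lra.
  replace (p ⊖ e ⊙ v) with (p ⊕ (- e) ⊙ v) by vring. apply H; lra.
Qed.

Lemma minimizers_dim_bound n y : (forall i, (i < n)%nat -> dir S p (y i)) ->
  indep_mod KL n y -> (n <= j)%nat.
Proof.
  now apply quotient_dir_bound with q1; auto using minimizers_convex.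
Qed.

Lemma strict_bound (X : RVS) (g : X -> ereal) u r : elt (g u) (EFin r) ->
  exists r', r' < r /\ ele (g u) (EFin r').
Proof. destruct (g u) as [a|]; simpl; try contradiction. exists a. split; auto. lra. Qed.

Lemma sum_proper : (exists u, elt (Rf u) (Rf p)) \/ (exists w, elt (f w) (f (Phi p))) ->
  exists w, forall u v, dir A p u -> dir B (Phi p) v -> w <> Phi u ⊕ v.
Proof.
  rewrite Erp, Efp. intros [[u0 H0]|[w0 H0]]; apply strict_bound in H0 as (r & Hr & H0).
  - exists (Phi (u0 ⊖ p)). intros u v Hu Hv E.
    destruct (dir_le _ _ _ levR_convex Hu) as (a & Ha & HA').
    destruct (dir_le _ _ _ levf_convex Hv) as (b & Hb & HB').
    (* The bound [a / (1 + a)] gives [t < 1] and [s = t / (1 - t) <= a]. The mixture of [u0] and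
       [p - su] with weight [t] has image [Phi p + tv], so [f] does not exceed [fp] there while [Rf]
       is strictly below [rp]. *)
    destruct (Rmin_pos2 (a / (1 + a)) b) as (t & Ht & Hta & Htb); auto.
    { apply Rdiv_lt_0_compat; lra. }
    assert (Ea : a / (1 + a) * (1 + a) = a) by (field; lra).
    assert (Ht1 : t < 1) by nra.
    assert (Hs : 0 < t / (1 - t)) by (apply Rdiv_lt_0_compat; lra).
    assert (Es : t / (1 - t) * (1 - t) = t) by (field; lra).
    set (s := t / (1 - t)) in *.
    assert (H1 : ele (Rf (p ⊕ (- s) ⊙ u)) (EFin rp)) by (apply levR_iff, HA'; nra).
    assert (H2 := HR u0 (p ⊕ (- s) ⊙ u) r rp t H0 H1 ltac:(lra)).
    assert (H3 : ele (f (Phi (t ⊙ u0 ⊕ (1 - t) ⊙ (p ⊕ (- s) ⊙ u)))) (EFin fp)).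
    { apply levf_iff.
      replace (t ⊙ u0 ⊕ (1 - t) ⊙ (p ⊕ (- s) ⊙ u)) with (p ⊕ t ⊙ (u0 ⊖ p) ⊕ (- t) ⊙ u).
      - rewrite !Phi_line, E.
        replace (Phi p ⊕ t ⊙ (Phi u ⊕ v) ⊕ (- t) ⊙ Phi u) with (Phi p ⊕ t ⊙ v) by vring.
        apply HB'. lra.
      - rewrite <- Es at 2. vcoefs; ring. }
    pose proof (optimal _ _ _ H2 H3). nra.
  - exists (w0 ⊖ Phi p). intros u v Hu Hv E.
    destruct (dir_le _ _ _ levR_convex Hu) as (a & Ha & HA').
    destruct (dir_le _ _ _ levf_convex Hv) as (b & Hb & HB').
    (* Symmetric: the mixture of [w0] and [Phi p - sv] is the image of [p + tu], where [f] is
       strictly below [fp]. *)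
    destruct (Rmin_pos2 a (b / (1 + b))) as (t & Ht & Hta & Htb); auto.
    { apply Rdiv_lt_0_compat; lra. }
    assert (Ea : b / (1 + b) * (1 + b) = b) by (field; lra).
    assert (Ht1 : t < 1) by nra.
    assert (Hs : 0 < t / (1 - t)) by (apply Rdiv_lt_0_compat; lra).
    assert (Es : t / (1 - t) * (1 - t) = t) by (field; lra).
    set (s := t / (1 - t)) in *.
    assert (H1 : ele (f (Phi p ⊕ (- s) ⊙ v)) (EFin fp)) by (apply levf_iff, HB'; nra).
    assert (H2 := Hf w0 (Phi p ⊕ (- s) ⊙ v) r fp t H0 H1 ltac:(lra)).
    assert (H3 : ele (Rf (p ⊕ t ⊙ u)) (EFin rp)) by (apply levR_iff, HA'; lra).
    replace (t ⊙ w0 ⊕ (1 - t) ⊙ (Phi p ⊕ (- s) ⊙ v)) with (Phi (p ⊕ t ⊙ u)) in H2.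
    + pose proof (optimal _ _ _ H3 H2). nra.
    + rewrite Phi_line. replace w0 with ((w0 ⊖ Phi p) ⊕ Phi p) by vring. rewrite E.
      transitivity (Phi p ⊕ t ⊙ Phi u ⊕ (t - s * (1 - t)) ⊙ v).
      * rewrite Es. vring.
      * vring.
Qed.

(** The [s] vectors that [rank_count] sends into the directions of [B] are directions of [S], so
    [s <= j]. *)
Lemma level_dim_bound n v : (forall i, (i < n)%nat -> dir A p (v i)) -> indep_mod K n v ->
  (d + n + l <= j + m)%nat /\
  ((exists u, elt (Rf u) (Rf p)) \/ (exists w, elt (f w) (f (Phi p))) ->
   (d + n + l + 1 <= j + m)%nat).
Proof.
  intros Hv Iv. destruct (lifted_family n v Hv Iv) as (x & Hx & Ix).
  destruct level_family as (b & Hb & Ib).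
  destruct (rank_count Phi (dir A p) KL (dir B (Phi p)) (d + n) l m x b)
    as (s & y & Hy & Iy & H1 & H2);
    auto using sub_dir, levR_convex, levf_convex, levR_self, levf_self, sub_KL, vdim_Rn.
  assert (s <= j)%nat.
  { apply minimizers_dim_bound with y; auto. intros i Hi. destruct (Hy i Hi).
    now apply dir_minimizers. }
  split. lia. intros H'. specialize (H2 (sum_proper H')). lia.
Qed.

(** * Directions of the epigraph and the hypograph *)

Let Epi : prodRVS V Rsp -> Prop := epi Rf.
Let Hypo : prodRVS (Rn m) Rsp -> Prop := hypo_Mminus (rp + fp) f.
Let pE : prodRVS V Rsp := (p, rp).
Let pH : prodRVS (Rn m) Rsp := (Phi p, rp).
Let T : prodRVS V Rsp -> prodRVS (Rn m) Rsp := fun z => (Phi (fst z), snd z).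

Lemma lift_linear : linear_map T.
Proof.
  destruct HPhi as [Pa Ps]. split; intros; unfold T; simpl; now rewrite ?Pa, ?Ps.
Qed.

Lemma epiR_self : Epi pE.
Proof. red; red; simpl. rewrite Erp. simpl. lra. Qed.

Lemma hypof_self : Hypo pH.
Proof. apply hypo_mem. rewrite Efp. simpl. lra. Qed.

Lemma epiR_convex : convex_set Epi.
Proof. now apply epi_convex. Qed.

Lemma hypof_convex : convex_set Hypo.
Proof. now apply hypo_convex. Qed.

Lemma dir_epi v : dir A p v -> dir Epi pE (v, 0).
Proof.
  intros (e & He & H1 & H2). apply levR_iff in H1, H2.
  exists e. split; auto. unfold Epi, epi, pE. simpl.
  split; [replace (rp + e * 0) with rp by ring | replace (rp + - (e * 0)) with rp by ring]; auto.
Qed.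

Lemma dir_hypo w : dir B (Phi p) w -> dir Hypo pH (w, 0).
Proof.
  intros (e & He & H1 & H2). apply levf_iff in H1, H2.
  exists e. split; auto. split; apply hypo_mem; simpl.
  - now replace (rp + fp - (rp + e * 0)) with fp by ring.
  - now replace (rp + fp - (rp + - (e * 0))) with fp by ring.
Qed.

Lemma dir_epi_le z : dir Epi pE z -> exists e, 0 < e /\
  forall t, - e <= t <= e -> ele (Rf (p ⊕ t ⊙ fst z)) (EFin (rp + t * snd z)).
Proof.
  intros H. destruct (dir_le _ _ _ epiR_convex H) as (e & He & H'). exists e. split; auto.
Qed.

Lemma dir_hypo_le z : dir Hypo pH z -> exists e, 0 < e /\
  forall t, - e <= t <= e -> ele (f (Phi p ⊕ t ⊙ fst z)) (EFin (fp - t * snd z)).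
Proof.
  intros H. destruct (dir_le _ _ _ hypof_convex H) as (e & He & H'). exists e. split; auto.
  intros t Ht. specialize (H' t Ht). destruct z as [w s]. apply hypo_mem in H'. simpl in *.
  now replace (fp - t * s) with (rp + fp - (rp + t * s)) by ring.
Qed.

(** Along [z] the bounds on [Rf] and [f] change by opposite amounts [t * snd z], so their sum stays
    optimal. *)
Lemma dir_minimizers_oblique z : dir Epi pE z -> dir Hypo pH (T z) -> dir S p (fst z).
Proof.
  intros HE HH. destruct (dir_epi_le z HE) as (a & Ha & HE').
  destruct (dir_hypo_le _ HH) as (b & Hb & HH').
  destruct (Rmin_pos2 a b) as (e & He & Hea & Heb); auto.
  assert (H : forall t, - e <= t <= e -> S (p ⊕ t ⊙ fst z)).
  { intros t Ht. apply minimizer_intro with (rp + t * snd z) (fp - t * snd z); [| |lra].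
    - apply HE'. lra.
    - rewrite Phi_line. apply HH'. lra. }
  exists e. split; auto. split. apply H; lra.
  replace (p ⊖ e ⊙ fst z) with (p ⊕ (- e) ⊙ fst z) by vring. apply H; lra.
Qed.

(** If the vertical vector were such a sum, a step [-e] along [u] and a step [e] along [v] would
    reach the same point of [R^m] and lower the objective by [e]. *)
Lemma sum_proper_oblique : exists w, forall u v, dir Epi pE u -> dir Hypo pH v -> w <> T u ⊕ v.
Proof.
  exists (vzero, 1). intros u v Hu Hv E.
  destruct (dir_epi_le u Hu) as (a & Ha & HE').
  destruct (dir_hypo_le v Hv) as (b & Hb & HH').
  destruct (Rmin_pos2 a b) as (e & He & Hea & Heb); auto.
  destruct u as [u s], v as [v s']. cbn [fst snd] in HE', HH'.
  assert (E1 : Phi u ⊕ v = vzero) by (symmetry; exact (f_equal fst E)).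
  assert (E2 : 1 = s + s') by exact (f_equal snd E).
  assert (H1 := HE' (- e) ltac:(lra)). assert (H2 := HH' e ltac:(lra)).
  replace (Phi p ⊕ e ⊙ v) with (Phi (p ⊕ (- e) ⊙ u)) in H2.
  - pose proof (optimal _ _ _ H1 H2). nra.
  - rewrite Phi_line. replace v with ((Phi u ⊕ v) ⊖ Phi u) by vring. rewrite E1. vring.
Qed.

(** Subtracting the horizontal direction [(u, 0)] leaves a vertical one, but [pE] lies on the graph
    and nothing below it is in the epigraph. *)
Lemma lineality_no_vertical u s : K u -> dir Epi pE (u, s) -> s = 0.
Proof.
  intros Ku H.
  assert (H0 : dir Epi pE (u, 0)) by (apply dir_epi, lineality_dir; auto using levR_self).
  pose proof (sub_sub _ (sub_dir Epi pE epiR_convex epiR_self) _ _ H H0) as D.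
  destruct (dir_epi_le _ D) as (e & He & H'). simpl in H'.
  assert (H1 := H' e ltac:(lra)). assert (H2 := H' (- e) ltac:(lra)).
  replace (p ⊕ e ⊙ (u ⊖ u)) with p in H1 by vring.
  replace (p ⊕ (- e) ⊙ (u ⊖ u)) with p in H2 by vring.
  rewrite Erp in H1, H2. simpl in H1, H2. nra.
Qed.

(** Each horizontal family gains one oblique vector, the target gains one dimension, and the
    vertical vector is outside the sum: [(d + n + 1) + (l + 1) + 1 <= s + (m + 1)]. *)
Lemma level_dim_bound_oblique n v : oblique p rp (epi Rf) ->
  oblique (Phi p) rp (hypo_Mminus (rp + fp) f) ->
  (forall i, (i < n)%nat -> dir A p (v i)) -> indep_mod K n v ->
  (d + n + l + 2 <= j + m)%nat.
Proof.
  intros OR Of Hv Iv.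
  destruct (oblique_dir p rp (epi Rf) epiR_convex epiR_self OR) as (v0 & s0 & Hs0 & D0).
  destruct (oblique_dir (Phi p) rp _ hypof_convex hypof_self Of) as (b0 & t0 & Ht0 & B0).
  destruct (lifted_family n v Hv Iv) as (x & Hx & Ix).
  destruct level_family as (b & Hb & Ib).
  set (P := fun z : prodRVS V Rsp => KL (fst z) /\ snd z = 0).
  assert (HP : subspace P).
  { destruct sub_KL as (K0 & Ka & Ks). split; [|split].
    - split; auto.
    - intros [u r] [u' r'] [Hu Hr] [Hu' Hr']; simpl in *. split; simpl; auto. lra.
    - intros a [u r] [Hu Hr]; simpl in *. split; simpl; auto. rewrite Hr. ring. }
  assert (Hsnd : forall (X : RVS) k (c : nat -> R) (g : nat -> X),
    lincomb k c (fun i => (g i, 0) : prodRVS X Rsp) = (lincomb k c g, 0)).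
  { intros X k c g. unfold lincomb. induction k as [|k IHk]; auto.
    change (vsum k (fun i => c i ⊙ ((g i, 0) : prodRVS X Rsp)) ⊕ c k ⊙ ((g k, 0) : prodRVS X Rsp)
      = (vsum k (fun i => c i ⊙ g i) ⊕ c k ⊙ g k, 0) :> prodRVS X Rsp).
    rewrite IHk. simpl. f_equal. ring. }
  assert (HD0 : forall (X : RVS) k (g : nat -> X) u (r : R) w, r <> 0 ->
    span k (fun i => (g i, 0) : prodRVS X Rsp) w ->
    snd (((u, r) : prodRVS X Rsp) ⊖ w) <> 0).
  { intros X k g u r w Hr [c ->]. rewrite Hsnd. simpl. lra. }
  set (x' := snoc (d + n) (fun i => (x i, 0) : prodRVS V Rsp) (v0, s0)).
  set (b' := snoc l (fun i => (b i, 0) : prodRVS (Rn m) Rsp) (b0, t0)).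
  assert (Ix' : indep_mod P (Datatypes.S (d + n)) x').
  { apply indep_snoc; auto.
    - intros c Hc. rewrite Hsnd in Hc. apply Ix. apply Hc.
    - intros w Hw [_ H]. revert H. now apply HD0 with (1 := Hs0) (2 := Hw). }
  assert (Ib' : indep_mod null (Datatypes.S l) b').
  { apply indep_snoc; auto using sub_null.
    - intros c Hc. rewrite Hsnd in Hc. apply Ib. exact (f_equal fst Hc).
    - intros w Hw H. apply (HD0 _ _ _ b0 t0 w Ht0 Hw). rewrite H. reflexivity. }
  destruct (rank_count T (dir Epi pE) P (dir Hypo pH) (Datatypes.S (d + n)) (Datatypes.S l)
    (Datatypes.S m) x' b') as (s & y & Hy & Iy & _ & H2);
    auto using sub_dir, epiR_convex, hypof_convex, epiR_self, hypof_self, vdim_Rn, vdim_prod_R, lift_linear.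
  - apply snoc_forall; auto. intros i Hi. now apply dir_epi, Hx.
  - apply snoc_forall; auto. intros i Hi. now apply dir_hypo, Hb.
  - specialize (H2 sum_proper_oblique).
    assert (s <= j)%nat; [|lia].
    apply minimizers_dim_bound with (fun i => fst (y i)).
    + intros i Hi. destruct (Hy i Hi). now apply dir_minimizers_oblique.
    (* Independence is known modulo [P], which also requires height 0; [lineality_no_vertical]
       supplies it. *)
    + intros c Hc. apply Iy.
      rewrite <- (linear_lincomb (fst : prodRVS V Rsp -> V) linear_fst) in Hc.
      split; auto. destruct Hc as [Kc _].
      assert (Dc : dir Epi pE (lincomb s c y)).
      { apply sub_lincomb; auto using sub_dir, epiR_convex, epiR_self. intros i Hi. now apply Hy. }
      apply lineality_no_vertical with (fst (lincomb s c y)); auto.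
Qed.
End Main.

Theorem theorem2 (V : RVS) (m : nat) (Rf : V -> ereal) (f : Rn m -> ereal)
  (Phi : V -> Rn m) (p : V)
  (Q1 : RVS) (q1 : V -> Q1) (Q2 : RVS) (q2 : V -> Q2) (j d l : nat) :
  convex_fun Rf -> convex_fun f -> linear_map Phi -> surjective_map Phi ->
  let S : V -> Prop :=
    fun u => forall v, ele (eadd (Rf u) (f (Phi u))) (eadd (Rf v) (f (Phi v))) in
  let K : V -> Prop := lineality (lev Rf p) in
  let L : V -> Prop := fun u => Phi u = vzero in
  S p ->
  elt (eadd (Rf p) (f (Phi p))) EInf ->
  linearly_closed (lev Rf p) ->
  (* q1 = pi_{K ∩ L} : V -> V/(K ∩ L) *)
  linear_map q1 -> surjective_map q1 -> (forall u, q1 u = vzero <-> (K u /\ L u)) ->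
  (* q2 = pi_K : V -> V/K *)
  linear_map q2 -> surjective_map q2 -> (forall u, q2 u = vzero <-> K u) ->
  affdim (image Phi K) d ->
  affdim (min_face (Phi p) (lev f (Phi p))) l ->
  affdim (image q1 (min_face p S)) j ->
  let base : Z := (Z.of_nat m - Z.of_nat l + Z.of_nat j - Z.of_nat d)%Z in
  let C : Q2 -> Prop := image q2 (lev Rf p) in
  let M : R := real_of (eadd (Rf p) (f (Phi p))) in
  (((exists u, elt (Rf u) (Rf p)) \/ (exists w, elt (f w) (f (Phi p)))) ->
     face_bound (q2 p) C (base - 1)) /\
  (~ ((exists u, elt (Rf u) (Rf p)) \/ (exists w, elt (f w) (f (Phi p)))) ->
     face_bound (q2 p) C base) /\
  ((oblique p (real_of (Rf p)) (epi Rf) /\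
    oblique (Phi p) (M - real_of (f (Phi p))) (hypo_Mminus M f)) ->
     face_bound (q2 p) C (base - 2)).
Proof.
  intros HR Hf HPhi _ S K L HS Hfin Hcl Hq1 _ Hker1 Hq2 Hs2 Hker2 Hd Hl Hj base C M.
  destruct (Rf p) as [rp|] eqn:Erp; [|contradiction].
  destruct (f (Phi p)) as [fp|] eqn:Efp; [|contradiction].
  assert (HA : convex_set (lev Rf p)) by now apply lev_convex with rp.
  assert (Ap : lev Rf p p) by (red; rewrite Erp; simpl; lra).
  rewrite <- Erp, <- Efp.
  pose proof (level_dim_bound Rf f Phi p q1 j d l rp fp HR Hf HPhi HS Erp Efp Hq1 Hker1 Hd Hl Hj)
    as HB.
  split; [|split].
  - intros H. apply quotient_face_bound; auto. intros n v Hv Iv.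
    destruct (HB n v Hv Iv) as [_ H']. specialize (H' H). unfold base. lia.
  - intros _. apply quotient_face_bound; auto. intros n v Hv Iv.
    destruct (HB n v Hv Iv) as [H' _]. unfold base. lia.
  - intros [OR Of]. apply quotient_face_bound; auto. intros n v Hv Iv.
    unfold M in Of. rewrite Erp in OR. rewrite Efp in Of. simpl in OR, Of.
    (* Both obliqueness conditions refer to the same height [rp]. *)
    replace (rp + fp - fp) with rp in Of by ring.
    pose proof (level_dim_bound_oblique Rf f Phi p q1 j d l rp fp HR Hf HPhi HS Erp Efp Hq1 Hker1
      Hd Hl Hj n v OR Of Hv Iv). unfold base. lia.
Qed.
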